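(* Let $\alpha>0$ and $\eta>0$. If $\mu\in\mathcal{M}_{\alpha}$, then $\tau:=K^{-}_{\alpha,\eta}\mu\in\mathcal{M}_{\alpha+\eta}$, and given $\tau$ we can recover $\mu$ from $$F_{\mu}(y)=\tau(\{0\})+\frac{1}{\Gamma(n+1-\eta)}\Biggl\{\alpha\int_{(0,y)}x^{\alpha-1}dx\left(-x^2\frac{d}{dx}\right)^n x^{\eta-n}\int_{(x,\infty)}\frac{\tau(ds)}{s^{\alpha+n}(s-x)^{\eta-n}}-y^{\alpha}\left(-y^2\frac{d}{dy}\right)^n y^{\eta-n}\int_{(y,\infty)}\frac{\tau(ds)}{s^{\alpha+n}(s-y)^{\eta-n}}\Biggr\},$$ where $n=[\eta]$, and $$\mu(\{\infty\})=\alpha\Gamma(\eta)\lim_{y\to\infty}y^{-\alpha}F_{\tau}(y).$$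
   Context: For $\alpha>0$, $\mathcal{M}_{\alpha}$ denotes the set of non-negative Borel measures $\mu$ on $[0,\infty]$ (the one-point compactification of $[0,\infty)$) with $\int_{[0,\infty)}(1+t)^{-\alpha}\mu(dt)<\infty$ and $\mu(\{\infty\})<\infty$; write $\mu_\infty=\mu(\{\infty\})$. For $\mu\in\mathcal{M}_\alpha$, $F_\mu$ is the left-continuous distribution function $F_{\mu}(x)=\mu([0,x))$, normalized by $F_\mu(0)=0$; it determines $\mu$ except for a possible atom at infinity. $[\eta]$ is the integer part of $\eta$. For $\mu\in\mathcal{M}_\alpha$ and $\eta>0$ the right-sided Kober-Erdelyi fractional integral $K^{-}_{\alpha,\eta}\mu$ is the measure $\tau$ on $[0,\infty]$, with no atom at infinity, given by $$\tau(B)=\mu(B\cap\{0\})+\frac{1}{\Gamma(\eta)}\int_{B\setminus\{0\}}y^{\alpha-1}dy\left\{\int_{(y,\infty)}\frac{\mu(du)}{u^{\eta+\alpha-1}(u-y)^{1-\eta}}+\mu_{\infty}\right\}$$ for each Borel set $B\subset[0,\infty]$. The operator $(-x^2\,d/dx)^n$ acts on the whole product to its right, and the result, multiplied by $x^{\alpha-1}$, is integrated over $(0,y)$ with respect to $x$; likewise $(-y^2\,d/dy)^n$ acts on the whole product to its right.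
   Formalization: The formula for F_μ(y) is asserted only for y > 0 with μ({y}) = 0; at an atom y it fails: for n = 0 the right side is μ([0,y]), and for n ≥ 1 the n-th derivative does not exist there; that τ determines μ is proved in full. *)

(* Defs.v *)
From HB Require Import structures.
From mathcomp Require Import all_boot all_order all_algebra.
From mathcomp Require Import all_classical all_reals all_analysis.
From mathcomp Require Import measurable_realfun.

Set Implicit Arguments.
Unset Strict Implicit.
Unset Printing Implicit Defensive.

Import Order.TTheory GRing.Theory Num.Theory.
Import numFieldNormedType.Exports.

Local Open Scope classical_set_scope.
Local Open Scope ring_scope.

Definition Gamma {R : realType} (a : R) : R :=
  \int[lebesgue_measure]_(t in `]0, +oo[) (t `^ (a - 1) * expR (- t)).

(* A Borel measure on [0,+oo] is encoded as a measure on the Borel sets of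
   \bar R for which the set of negative points is null.  On \bar R the library
   interval `[0, +oo[ contains +oo, so half-lines that exclude infinity are
   written as comprehensions. *)
Definition classM {R : realType} (alpha : R)
    (mu : {measure set (\bar R) -> \bar R}) : Prop :=
  [/\ mu [set t | (t < 0)%E] = 0%E,
      (\int[mu]_(t in [set t | (0 <= t < +oo)%E])
         ((1 + fine t) `^ (- alpha))%:E < +oo)%E
    & (mu [set +oo%E] < +oo)%E].

Definition cdf_left {R : realType}
    (mu : {measure set (\bar R) -> \bar R}) (x : R) : \bar R :=
  mu [set t | (0 <= t < x%:E)%E].

(* The set function B |-> (K^-_{alpha,eta} mu)(B).  Only the points of B in
   [0,+oo) contribute, so there is no mass at infinity or below 0. *)
Definition kober_erdelyi {R : realType} (alpha eta : R)
    (mu : {measure set (\bar R) -> \bar R}) (B : set (\bar R)) : \bar R :=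
  (mu (B `&` [set 0]) +
   ((Gamma eta)^-1)%:E *
   \int[lebesgue_measure]_(y in [set y : R | (0 < y)%R /\ B y%:E])
     ((y `^ (alpha - 1))%:E *
      (\int[mu]_(u in [set u | y%:E < u < +oo])
         ((fine u `^ (eta + alpha - 1) * (fine u - y) `^ (1 - eta))^-1)%:E
       + mu [set +oo])))%E.

Definition inv_kernel {R : realType} (alpha eta x : R) (s : \bar R) : R :=
  let n := Num.truncn eta in
  (fine s `^ (alpha + n%:R) * (fine s - x) `^ (eta - n%:R))^-1.

(* x^(eta-n) int_(x,oo) tau(ds) / (s^(alpha+n) (s-x)^(eta-n)), n = [eta] *)
Definition inv_base {R : realType} (alpha eta : R)
    (tau : {measure set (\bar R) -> \bar R}) (x : R) : R :=
  x `^ (eta - (Num.truncn eta)%:R) *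
  \int[tau]_(s in [set s | (x%:E < s < +oo)%E]) inv_kernel alpha eta x s.

(* - x^2 d/dx; derive1 is total, with an unspecified value at points where f is
   not derivable. *)
Definition opD {R : realType} (f : R -> R) (x : R) : R :=
  - x ^+ 2 * derive1 f x.

Definition inv_iter {R : realType} (alpha eta : R)
    (tau : {measure set (\bar R) -> \bar R}) (k : nat) : R -> R :=
  iter k opD (inv_base alpha eta tau).

(* This equals F_mu(y) when mu has no atom at y > 0.  At an atom of mu the n-th
   derivative does not exist when n >= 1, and for n = 0 the value is mu([0,y])
   instead of mu([0,y)): the integrals over the open half-lines (y,oo) give a
   right-continuous function of y. *)
Definition inversion_rhs {R : realType} (alpha eta : R)
    (tau : {measure set (\bar R) -> \bar R}) (y : R) : \bar R :=
  let n := Num.truncn eta in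
  (tau [set 0] +
   ((Gamma (n%:R + 1 - eta))^-1 *
    (alpha * \int[lebesgue_measure]_(x in `]0%R, y[)
               (x `^ (alpha - 1) * inv_iter alpha eta tau n x)
     - y `^ alpha * inv_iter alpha eta tau n y))%:E)%E.

(* All the total operators (integrals, derivatives) in inversion_rhs have their
   intended meaning: the inner integral converges at every x > 0; of the n
   successive derivatives all but the last exist everywhere on (0,oo), and the
   last one exists away from the atoms of mu (at an atom the one-sided
   derivatives differ); the outer integrals converge. *)
Definition inversion_well_defined {R : realType} (alpha eta : R)
    (mu tau : {measure set (\bar R) -> \bar R}) : Prop :=
  let n := Num.truncn eta in
  [/\ forall x : R, 0 < x ->
        tau.-integrable [set s | (x%:E < s < +oo)%E]
          (EFin \o inv_kernel alpha eta x),
      forall (x : R) (k : nat), 0 < x -> (k < n)%N ->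
        (k.+1 < n)%N \/ mu [set x%:E] = 0%E ->
        derivable (inv_iter alpha eta tau k) x 1
    & forall y : R, 0 < y ->
        lebesgue_measure.-integrable `]0, y[
          (fun x => (x `^ (alpha - 1) * inv_iter alpha eta tau n x)%:E)].

(* Main.v *)
Require Import Defs.
From HB Require Import structures.
From mathcomp Require Import all_boot all_order all_algebra.
From mathcomp Require Import all_classical all_reals all_analysis.
From mathcomp Require Import measurable_realfun.
From mathcomp Require Import ring lra.
Import Order.TTheory GRing.Theory Num.Theory.
Import numFieldNormedType.Exports.

(** The substitution [w = 1 / t] turns the Kober-Erdelyi integral into a
    Riemann-Liouville integral on the half-line, where everything reduces to the
    semigroup law of truncated powers.

    Send [t] to [1 / t] (and infinity to [0]) and weight the image with
    [t `^ (- alpha)] (with [1] at infinity).  The restriction of [mu] to the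
    points above [0] becomes a measure [rho] on [[0, oo)] which is finite on
    bounded sets because [mu] is in the class; the atom of [mu] at
    infinity is now an ordinary atom of [rho] at [0]
    ([inverted_measure_exists], [inverted_lty]).  Write [tpow a t] for
    [t `^ (a - 1)] when [t > 0] and [0] otherwise, and [RL rho a] for the
    convolution of [tpow a] with [rho].  As
    [1 / y - 1 / t = (t - y) / (y t)], the braces in the definition of the
    transform are [y `^ (eta - 1) * RL rho eta (1 / y)]
    ([kober_erdelyi_inner]), so that [tau] has the density
    [y `^ (alpha + eta - 2) * RL rho eta (1 / y) / Gamma eta] on [(0, oo)]
    ([kober_erdelyi_density]).

    Let [n] be the integer part of [eta] and [theta = eta - n].  The base function
    of the inversion formula integrates this density against a kernel which,
    after the same substitution, is [tpow (1 - theta)] at [1 / x].  Since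
    [tpow a] convolved with [tpow b] is a Beta factor times [tpow (a + b)]
    ([RL_semigroup], [ebetaE]), the base function is [Gamma (1 - theta)] times
    [RLn rho n (1 / x)], where [RLn rho n] is [RL rho (n + 1) / n!]
    ([inv_baseE]).  The operator [- x ^ 2 * d/dx] is [d/dX] for
    [X = 1 / x], and the derivative of [RLn rho n.+1] is [RLn rho n]
    ([RLnS_is_derive]): the increment over [[a, b]] lies between [b - a] times
    the end values of the monotone function [RLn rho n].  The function [RLn rho 0]
    jumps at the atoms of [rho], and only there can a derivative fail.  Hence, away
    from the countably many atoms, the [n]-th iterate at [x] is
    [Gamma (1 - theta)] times the mass of [rho] below [1 / x]
    ([inv_iter_spec]), and Tonelli applied to this mass gives the formula for
    [mu] ([integral_RL1_mass], [inversion_formula]).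

    The same Tonelli computation with [eta] in place of [1]
    ([integral_power_RL]) expresses the distribution function of [tau]; the
    kernel that appears is bounded by a constant times the minimum of [1] and
    [(y / t) `^ alpha] ([cint_bound]), so that dominated convergence leaves
    only the atom at infinity in the limit ([cdf_left_tau_cvg]).  Finally [tau]
    determines [mu]: two candidates have the same distribution function away from
    their atoms, thus everywhere by left-continuity, and the same atom at
    infinity by the limit ([classM_measure_unique]). *)

Local Open Scope classical_set_scope.
Local Open Scope ring_scope.
Set Implicit Arguments.
Unset Strict Implicit.

(** * Densities, product integrals and atoms *)

Lemma integral_boolE d (T : measurableType d) (R : realType)
    (m : {measure set T -> \bar R}) (D : set T) (p : T -> bool) (f : T -> \bar R) :
  (forall x, D x <-> p x) ->
  (\int[m]_(x in D) f x = \int[m]_x (if p x then f x else 0))%E.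
Proof.
move=> Dp; rewrite integral_mkcond; apply: eq_integral => x _; rewrite patchE.
case: ifPn => [/set_mem/Dp ->//|/negP xD]; case: ifPn => // /Dp Dx.
by exfalso; apply: xD; rewrite inE.
Qed.

Section ImageOfDensity.
Local Open Scope ereal_scope.
Context d1 d2 (T1 : measurableType d1) (T2 : measurableType d2) (R : realType).
Variables (m : {measure set T1 -> \bar R}) (phi : T1 -> T2) (g : T1 -> \bar R).
Hypotheses (mphi : measurable_fun setT phi) (mg : measurable_fun setT g).
Hypothesis g0 : forall x, 0 <= g x.

Let mpre (A : set T2) : measurable A -> measurable (phi @^-1` A).
Proof. by move=> mA; rewrite -[X in measurable X]setTI; exact: mphi. Qed.

(** The image under [phi] of the measure with density [g]. *)
Lemma image_density_exists : exists nu : {measure set T2 -> \bar R},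
  forall A, nu A = \int[m]_(x in phi @^-1` A) g x.
Proof.
pose nu A := \int[m]_(x in phi @^-1` A) g x.
have nu0 : nu set0 = 0 by rewrite /nu preimage_set0 integral_set0.
have nu_ge0 A : 0 <= nu A by apply: integral_ge0 => x _; exact: g0.
have nu_add : semi_sigma_additive nu.
  move=> F mF tF mUF; rewrite /nu preimage_bigcup; apply: cvg_toP.
    apply: ereal_nondecreasing_is_cvgn => a b ab.
    by apply: lee_sum_nneg_natr => // k _ _; exact: nu_ge0.
  rewrite ge0_integral_bigcup//=.
  - by move=> k; exact: mpre.
  - exact: measurable_funTS.
  - apply/trivIsetP => /= i j _ _ ij; rewrite -preimage_setI.
    by move/trivIsetP : tF => /(_ _ _ _ _ ij) ->//; rewrite preimage_set0.
by exists (HB.pack_for {measure set T2 -> \bar R} nu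
  (isMeasure.Build _ _ _ nu nu0 nu_ge0 nu_add)).
Qed.

Variable nu : {measure set T2 -> \bar R}.
Hypothesis nuE :
  forall A, measurable A -> nu A = \int[m]_(x in phi @^-1` A) g x.

Import HBNNSimple.

Let integral_simple (f : {nnsfun T2 >-> R}) :
  \int[nu]_y (f y)%:E = \int[m]_x ((f (phi x))%:E * g x).
Proof.
under eq_integral do rewrite fimfunE -fsumEFin//.
rewrite ge0_integral_fsum//; last 2 first.
- by move=> r; exact/measurable_EFinP/measurable_funM.
- by move=> r y _; rewrite nnfun_muleindic_ge0.
have mI (r : R) : measurable_fun setT
    (fun x => (\1_(f @^-1` [set r]) (phi x))%:E : \bar R).
  apply/measurable_EFinP; apply: (measurableT_comp _ mphi) => //.
transitivity (\sum_(r \in range f)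
   \int[m]_x ((r * \1_(f @^-1` [set r]) (phi x))%:E * g x)).
  apply: eq_fsbigr => r _.
  have [r0|r0] := ltP r 0%R.
    have -> : f @^-1` [set r] = set0 by rewrite preimage_nnfun0.
    by rewrite !integral0_eq// => x _; rewrite indic0 mulr0 ?mul0e.
  rewrite integralZl_indic_nnsfun// integral_indic// setIT nuE//.
  under [RHS]eq_integral do rewrite EFinM -muleA.
  rewrite ge0_integralZl//; last 2 first.
    by apply: emeasurable_funM.
    by move=> x _; rewrite mule_ge0// lee_fin.
  congr (_ * _); rewrite integral_mkcond; apply: eq_integral => x _.
  rewrite patchE indicE; have [/set_mem/= fx|/negP fx] := boolP (x \in _).
    by rewrite mem_set// mul1e.
  by rewrite memNset ?mul0e// => /= fx'; apply: fx; rewrite inE.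
rewrite -ge0_integral_fsum//.
- apply: eq_integral => x _; rewrite [f (phi x)]fimfunE -fsumEFin//.
  rewrite ge0_mule_fsuml// => r.
  by rewrite nnfun_muleindic_ge0.
- move=> r; apply: emeasurable_funM => //.
  under eq_fun do rewrite EFinM.
  exact: emeasurable_funM.
- by move=> r x _; rewrite mule_ge0// nnfun_muleindic_ge0.
Qed.

(** Both sides are determined by their values on simple functions, by monotone
    convergence; on indicators the formula is the definition of [nu]. *)
Lemma integral_image_density (D : set T2) (f : T2 -> \bar R) :
  measurable D -> measurable_fun D f -> (forall y, D y -> 0 <= f y) ->
  \int[nu]_(y in D) f y = \int[m]_(x in phi @^-1` D) (f (phi x) * g x).
Proof.
move=> mD mf f0; rewrite integral_mkcond [RHS]integral_mkcond.
pose h := f \_ D.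
have mh : measurable_fun setT h by apply/measurable_restrict => //; rewrite setTI.
have h0 y : 0 <= h y by apply: erestrict_ge0.
transitivity (\int[m]_x (h (phi x) * g x)); last first.
  apply: eq_integral => x _; rewrite /h !patchE.
  have [/set_mem/= Dx|/negP Dx] := boolP (phi x \in D).
    by rewrite mem_set.
  by rewrite memNset ?mul0e// => /= Dx'; apply: Dx; rewrite inE.
rewrite -/h; pose h_ := nnsfun_approx measurableT mh.
transitivity (\int[nu]_y limn (fun n => (h_ n y)%:E)).
  by apply: eq_integral => y _; apply/esym/cvg_lim => //; exact: cvg_nnsfun_approx.
rewrite monotone_convergence//; last 3 first.
- by move=> n; exact/measurable_EFinP.
- by move=> n y _; rewrite lee_fin.
- by move=> y _ a b ab; rewrite lee_fin; exact/lefP/nd_nnsfun_approx.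
under eq_fun do rewrite integral_simple.
rewrite -monotone_convergence//.
- apply: eq_integral => x _; apply/cvg_lim => //.
  have hx : (h_ n (phi x))%:E @[n --> \oo] --> h (phi x).
    by apply: cvg_nnsfun_approx.
  have [hx0|hx0] := eqVneq (h (phi x)) 0.
    have hn0 n : h_ n (phi x) = 0%R.
      apply/eqP; rewrite eq_le fun_ge0 andbT.
      have : (h_ n (phi x))%:E <= h (phi x).
        by rewrite /h_ nnsfun_approxE; exact: le_approx.
      by rewrite hx0 lee_fin.
    by rewrite hx0 mul0e; under eq_fun do rewrite hn0 mul0e; exact: cvg_cst.
  have [->|gx0] := eqVneq (g x) 0.
    by under eq_fun do rewrite mule0; rewrite mule0; exact: cvg_cst.
  (* With both factors nonzero the product is never of the form [0 * +oo], hence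
     it is continuous there. *)
  apply: cvgeM => //; last exact: cvg_cst.
  have [gf|gf] := boolP (g x \is a fin_num); last exact: mule_def_neq0_infty.
  have [hf|hf] := boolP (h (phi x) \is a fin_num); first exact: mule_def_fin.
  exact: mule_def_infty_neq0.
- move=> n; apply: emeasurable_funM => //.
  by apply/measurable_EFinP; exact: (measurableT_comp _ mphi).
- by move=> n x _; rewrite mule_ge0// lee_fin.
- move=> x _ a b ab; apply: lee_wpmul2r => //.
  by rewrite lee_fin; exact/lefP/nd_nnsfun_approx.
Qed.
End ImageOfDensity.

Section Tonelli.
Local Open Scope ereal_scope.
Context d1 d2 (T1 : measurableType d1) (T2 : measurableType d2) (R : realType).
Variables (m1 : {measure set T1 -> \bar R}) (m2 : {measure set T2 -> \bar R}).
Variables (f : T1 * T2 -> \bar R).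
Hypotheses (mf : measurable_fun setT f) (f0 : forall z, 0 <= f z).

(** The measures of interest are obtained from existence statements, so
    sigma-finiteness is a hypothesis here, not a part of their structure. *)
Lemma sigma_finite_tonelli :
  sigma_finite setT m1 -> sigma_finite setT m2 ->
  \int[m1]_x \int[m2]_y f (x, y) = \int[m2]_y \int[m1]_x f (x, y).
Proof.
move=> s1 s2.
pose M1 : {sigma_finite_measure set T1 -> \bar R} :=
  HB.pack (Measure.sort m1)
    (@isSFinite.Build _ _ R m1 (sfinite_measure_sigma_finite s1))
    (@isSigmaFinite.Build _ _ R m1 s1).
pose M2 : {sigma_finite_measure set T2 -> \bar R} :=
  HB.pack (Measure.sort m2)
    (@isSFinite.Build _ _ R m2 (sfinite_measure_sigma_finite s2))
    (@isSigmaFinite.Build _ _ R m2 s2).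
exact: (@fubini_tonelli _ _ _ _ _ M1 M2 f).
Qed.

Lemma sigma_finite_measurable_integral :
  sigma_finite setT m2 -> measurable_fun setT (fun x => \int[m2]_y f (x, y)).
Proof.
move=> s2.
pose M2 : {sigma_finite_measure set T2 -> \bar R} :=
  HB.pack (Measure.sort m2)
    (@isSFinite.Build _ _ R m2 (sfinite_measure_sigma_finite s2))
    (@isSigmaFinite.Build _ _ R m2 s2).
exact: (@measurable_fun_fubini_tonelli_F _ _ _ _ _ M2 f).
Qed.

End Tonelli.

(** Only finitely many points of [F] have mass at least [1 / n]: an infinite
    sequence of them would add up to more than [m F]. *)
Lemma countable_atoms d (T : measurableType d) (R : realType)
    (m : {measure set T -> \bar R}) (F : set T) :
  (forall x : T, measurable [set x]) -> measurable F -> (m F < +oo)%E ->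
  countable [set x | F x /\ m [set x] != 0%E].
Proof.
move=> m1 mF mFoo.
have fin x : F x -> m [set x] \is a fin_num.
  move=> Fx; rewrite ge0_fin_numE//; apply: le_lt_trans mFoo.
  by apply: le_measure; rewrite ?inE// => _ ->.
have -> : [set x | F x /\ m [set x] != 0%E] =
    \bigcup_n [set x | F x /\ (n.+1%:R^-1%:E <= m [set x])%E].
  apply/seteqP; split=> [x [Fx mx]|x [n _ [Fx nx]]].
    have mx0 : 0 < fine (m [set x]).
      by rewrite fine_gt0// lt0e mx measure_ge0/= -ge0_fin_numE ?fin.
    exists (Num.truncn (fine (m [set x]))^-1) => //; split=> //.
    rewrite -[leRHS]fineK ?fin// lee_fin.
    rewrite -[leRHS]invrK lef_pV2 ?posrE ?invr_gt0//.
    by rewrite ltW// truncnS_gt.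
  split=> //; apply: contraTN nx => /eqP ->.
  by rewrite -ltNge lte_fin.
apply: bigcup_countable => // n _; apply: finite_set_countable.
apply: contrapT => /infiniteP/pcard_leP/injfunPex[/= q q_fun q_inj].
have qS k : F (q k) /\ (n.+1%:R^-1%:E <= m [set q k])%E by exact: q_fun.
have mU : measurable (\bigcup_k [set q k]) by apply: bigcup_measurable.
have UF : (m (\bigcup_k [set q k]) <= m F)%E.
  by apply: le_measure; rewrite ?inE// => _ [k _ ->]; exact: (qS k).1.
(* [N] points of mass [1 / n.+1] already weigh more than [F]. *)
pose N := (Num.truncn (fine (m F) * n.+1%:R)).+1.
suff : (m F < m (\bigcup_k [set q k]))%E by rewrite ltNge UF.
have tq : trivIset setT (fun k => [set q k]).
  apply/trivIsetP => i j _ _ ij; apply/seteqP; split=> // x [/= -> qij].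
  by move: ij; rewrite (q_inj _ _ (mem_set I) (mem_set I) qij) eqxx.
rewrite measure_bigcup//.
apply: (@lt_le_trans _ _ (\sum_(0 <= k < N) n.+1%:R^-1%:E)%E).
  rewrite sumEFin sumr_const_nat subn0 -[ltLHS]fineK ?ge0_fin_numE// lte_fin.
  by rewrite -[ltRHS]mulr_natl -ltr_pdivrMr ?invr_gt0// invrK truncnS_gt.
apply: (@le_trans _ _ (\sum_(0 <= k < N) m [set q k])%E).
  by apply: lee_sum => k _; exact: (qS k).2.
under [leRHS]eq_eseriesl do rewrite in_setT.
exact: nneseries_lim_ge.
Qed.

(** * Changes of variables for Lebesgue measure *)

Section LebesgueChangeOfVariables.
Context {R : realType}.
Local Notation leb := (@lebesgue_measure R).
Implicit Types f : R -> \bar R.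
Local Open Scope ereal_scope.

Lemma integral_oyE (a : R) f :
  \int[leb]_(x in `]a, +oo[) f x = \int[leb]_x (if (a < x)%R then f x else 0).
Proof. by apply: integral_boolE => x; rewrite /= in_itv/= andbT. Qed.

(** The image of [c] times Lebesgue measure under [x |-> c * x + d] gives every
    bounded interval its length. *)
Lemma integral_affine (c d : R) f : (0 < c)%R -> measurable_fun setT f ->
  (forall x, 0 <= f x) ->
  \int[leb]_x f x = c%:E * \int[leb]_x f (c * x + d)%R.
Proof.
move=> c0 mf f0.
pose phi (x : measurableTypeR R) : measurableTypeR R := (c * x + d)%R.
have mphi : measurable_fun setT phi by apply: measurable_funD => //; exact: measurable_funM.
have [nu nuE] := @image_density_exists _ _ _ _ R leb phi (cst c%:E) mphi
  (@measurable_cst _ _ _ _ _ _) (fun=> ltW c0).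
have phiitv a b : phi @^-1` `]a, b] = `]((a - d) / c)%R, ((b - d) / c)%R]%classic.
  apply/seteqP; split=> x; rewrite /phi /= !in_itv/= ltr_pdivrMr// ler_pdivlMr//;
    by rewrite ltrBlDr lerBrDr ![(x * c)%R]mulrC.
have nuleb A : measurable A -> leb A = nu A.
  apply: lebesgue_measure_unique => _ [[a b]] _ <-.
  rewrite nuE phiitv integral_cst// (lebesgue_measure_itv `]a, b]).
  rewrite [X in _ * X](lebesgue_measure_itv `](a - d) / c, (b - d) / c]%R)/= !lte_fin.
  rewrite ltr_pM2r ?invr_gt0// ltrD2r.
  case: ifPn => _; last by rewrite mule0.
  rewrite -!EFinB -EFinM; congr (_%:E); field; lra.
transitivity (\int[nu]_x f x); first by apply: eq_measure_integral => A mA _; exact: nuleb.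
rewrite (@integral_image_density _ _ _ _ R leb phi (cst c%:E) mphi
  (@measurable_cst _ _ _ _ _ _) (fun=> ltW c0) nu (fun A _ => nuE A))//.
rewrite preimage_setT; under eq_integral do rewrite muleC.
rewrite ge0_integralZl//.
- exact: (measurableT_comp mf mphi).
- by rewrite lee_fin ltW.
Qed.

Lemma integral_translation (d : R) f : measurable_fun setT f ->
  (forall x, 0 <= f x) -> \int[leb]_x f x = \int[leb]_x f (x + d)%R.
Proof.
move=> mf f0; rewrite (integral_affine d ltr01 mf f0) mul1e.
by apply: eq_integral => x _; rewrite mul1r.
Qed.

(** Complete [m] with Lebesgue measure on the nonpositive half-line and apply
    the uniqueness of Lebesgue measure on the whole line. *)
Lemma lebesgue_measure_unique_gt0 (m : {measure set (measurableTypeR R) -> \bar R}) :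
  (forall b : R, (0 < b)%R -> m `]0%R, b]%classic = b%:E) ->
  forall A : set (measurableTypeR R), measurable A ->
    A `<=` (`]0%R, +oo[%classic : set R) -> leb A = m A.
Proof.
move=> mb A mA A0.
have mp : measurable (`]0%R, +oo[%classic : set (measurableTypeR R)) by [].
have mn : measurable (`]-oo, 0%R]%classic : set (measurableTypeR R)) by [].
pose m' : {measure set (measurableTypeR R) -> \bar R} :=
  measure_add (mrestr m mp) (mrestr leb mn).
have m'E B : m' B = m (B `&` `]0%R, +oo[%classic) + leb (B `&` `]-oo, 0%R]%classic).
  exact: measure_addE.
suff -> : leb A = m' A.
  rewrite m'E setIidl//.
  have -> : A `&` `]-oo, 0%R]%classic = set0.
    apply/seteqP; split=> // x [/A0/=]; rewrite !in_itv/= andbT.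
    by move=> ? ?; lra.
  by rewrite measure0 adde0.
have mb' b : (0 <= b)%R -> m `]0%R, b]%classic = b%:E.
  rewrite le_eqVlt => /predU1P[<-|]; last exact: mb.
  by rewrite set_itvoc0 measure0.
have mab a b : (0 <= a <= b)%R -> m `]a, b]%classic = (b - a)%R%:E.
  move=> /andP[a0 ab]; have b0 : (0 <= b)%R by exact: le_trans ab.
  have -> : `]a, b]%classic = `]0%R, b]%classic `\` `]0%R, a].
    apply/seteqP; split=> x /=; rewrite !in_itv/=.
      by move=> /andP[ax xb]; split; [lra|apply/negP; lra].
    move=> [/andP[x0 xb]] /negP; rewrite x0/= -ltNge => ->//.
  rewrite measureD//= ?mb' ?ltry//.
  rewrite setIidr ?mb'//.
  by move=> x /=; rewrite !in_itv/= => /andP[-> xa]/=; exact: le_trans ab.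
refine (@lebesgue_measure_unique R m' _ A mA) => _ [[a b]] _ <-.
rewrite m'E /=.
have [ba|ab] := leP b a.
  by rewrite set_itv_ge ?set0I ?measure0 ?adde0//= bnd_simp -leNgt.
have -> : `]a, b]%classic `&` `]0%R, +oo[%classic = `](Num.max a 0%R), b]%classic.
  by apply/seteqP; split=> x /=; rewrite !in_itv/= gt_max andbT; lra.
have -> : `]a, b]%classic `&` `]-oo, 0%R]%classic = `]a, (Num.min b 0%R)]%classic.
  by apply/seteqP; split=> x /=; rewrite !in_itv/= le_min; lra.
rewrite !lebesgue_measure_itv/= !lte_fin ab.
have [b0|b0] := leP b 0%R.
  rewrite ab [X in m X](_ : _ = set0) ?measure0 ?add0e//.
  by rewrite set_itv_ge// bnd_simp -leNgt le_max b0 orbT.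
have [a0|a0] := leP 0%R a.
  by rewrite mab ?a0 ?ltW// adde0 EFinB.
by rewrite mab ?lexx ?ltW// -!EFinB -EFinD; congr (_%:E); lra.
Qed.

Lemma powRN_cvg0 (a : R) : (0 < a)%R -> (x `^ (- a))%R @[x --> +oo%R] --> 0%R.
Proof.
move=> a0; apply/cvgrPdist_lt => e e0; near=> x.
have x0 : (0 < x)%R by near: x; exact: nbhs_pinfty_gt.
rewrite sub0r normrN ger0_norm ?powR_ge0// powRN -[ltRHS]invrK.
rewrite ltf_pV2 ?posrE ?invr_gt0 ?powR_gt0//.
have -> : (e^-1 = (e `^ (- a^-1)) `^ a)%R.
  by rewrite -powRrM mulNr mulVf ?gt_eqF// powR_inv1// ltW.
apply: gt0_ltr_powR; rewrite ?nnegrE ?powR_ge0 ?(ltW x0)//.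
Unshelve. all: by end_near.
Qed.

Lemma integral_powR_tail (a b : R) : (0 < a)%R -> (0 < b)%R ->
  \int[leb]_(x in `[b, +oo[) (x `^ (- a - 1))%:E = (b `^ (- a) / a)%:E.
Proof.
move=> a0 b0; have aN0 : a != 0%R by rewrite gt_eqF.
have dF (x : R) : (0 < x)%R ->
    is_derive x 1%R (fun x : R => (- a^-1) *: (x `^ (- a)))%R (x `^ (- a - 1))%R.
  move=> x0; have dx := @is_derive1_powR R (- a) x x0.
  apply: is_derive_eq; rewrite /GRing.scale/=; field => //.
rewrite (@ge0_continuous_FTC2y _ (fun x => x `^ (- a - 1))%R
  (fun x => (- a^-1) *: (x `^ (- a)))%R b 0%R).
- by rewrite -EFinB sub0r /GRing.scale/= mulNr opprK mulrC.
- by move=> x _; exact: powR_ge0.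
- apply: continuous_in_subspaceT => x; rewrite inE/= in_itv/= andbT => bx.
  apply: differentiable_continuous; apply/derivable1_diffP.
  by apply: derivable_powR; rewrite in_itv/= andbT; exact: lt_le_trans bx.
- rewrite -(scaler0 _ (- a^-1)%R); apply: cvgZr; exact: powRN_cvg0.
- by move=> x bx; have [] := dF x (lt_trans b0 bx).
- apply: cvg_at_right_filter; have [dFb _] := dF b b0.
  by move/derivable1_diffP/differentiable_continuous : dFb.
- move=> x; rewrite in_itv/= andbT => bx.
  by rewrite derive1E; have [_ ->] := dF x (lt_trans b0 bx).
Qed.

(** The image under [x |-> 1 / x] of the density [x ^- 2] gives [[0, b]] the mass
    of [x ^- 2] beyond [1 / b], which is [b]. *)
Lemma integral_inversion f : measurable_fun setT f -> (forall x, 0 <= f x) ->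
  \int[leb]_(x in `]0%R, +oo[) f x =
  \int[leb]_(x in `]0%R, +oo[) (f (x^-1)%R * (x ^- 2)%R%:E).
Proof.
move=> mf f0.
(* A real power is measurable as it stands; it is the inverse for [x > 0]. *)
pose phi (x : measurableTypeR R) : measurableTypeR R := (x `^ (-1))%R.
have mphi : measurable_fun setT phi by exact: measurable_powR.
pose g (x : measurableTypeR R) : \bar R := (if (0 < x)%R then x `^ (-2) else 0)%R%:E.
have mg : measurable_fun setT g.
  apply/measurable_EFinP; apply: measurable_fun_ifT => //.
  exact: (@measurable_fun_ltr _ _ R setT (cst 0%R) id).
have g0 x : 0 <= g x by rewrite /g lee_fin; case: ifP => // _; exact: powR_ge0.
have [nu nuE] := @image_density_exists _ _ _ _ R leb phi g mphi mg g0.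
have nub (b : R) : (0 < b)%R -> nu `]0%R, b]%classic = b%:E.
  move=> b0; rewrite nuE.
  have -> : b%:E = \int[leb]_(x in `[(b^-1)%R, +oo[) (x `^ (- 1 - 1))%:E.
    rewrite integral_powR_tail ?invr_gt0// divr1 powR_inv1 ?invrK//.
    by rewrite invr_ge0 ltW.
  rewrite integral_mkcond [RHS]integral_mkcond; apply: eq_integral => x _.
  rewrite !patchE /g; have [x0|x0] := ltP 0%R x; last first.
    rewrite [in RHS]memNset; first by case: ifP.
    rewrite /= in_itv/= andbT; apply/negP.
    by rewrite -ltNge (le_lt_trans x0)// invr_gt0.
  have -> : (- 2 = - 1 - 1 :> R)%R by lra.
  have -> // : (x \in phi @^-1` `]0%R, b]%classic) = (x \in `[(b^-1)%R, +oo[%classic).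
  apply/idP/idP; rewrite !inE /phi /= powR_inv1 ?ltW// !in_itv/= invr_gt0 x0 andbT/=.
    by move=> xb; rewrite -[leRHS]invrK lef_pV2 ?posrE ?invr_gt0.
  by move=> xb; rewrite -[leRHS]invrK lef_pV2 ?posrE ?invr_gt0.
transitivity (\int[nu]_(x in `]0%R, +oo[) f x).
  by apply: eq_measure_integral => A mA A0; exact: lebesgue_measure_unique_gt0.
rewrite (@integral_image_density _ _ _ _ R leb phi g mphi mg g0 nu (fun A _ => nuE A))//;
  last exact: measurable_funTS.
rewrite integral_mkcond [RHS]integral_mkcond; apply: eq_integral => x _.
rewrite !patchE /g; have [x0|x0] := ltP 0%R x; last first.
  rewrite mule0 [in RHS]memNset; first by case: ifP.
  by rewrite /= in_itv/= andbT; apply/negP; rewrite -leNgt.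
rewrite !mem_set//= ?in_itv/= ?andbT//; last by rewrite powR_gt0.
by rewrite /phi powR_inv1 ?ltW// powR_invn ?ltW.
Qed.

(** The next lemmas restate standard facts with measurability expressed for the
    canonical structure of [R], which is only convertible to the one that
    carries Lebesgue measure. *)
Lemma lebesgue_integralZl (k : \bar R) f : measurable_fun setT f ->
  (forall x, 0 <= f x) -> 0 <= k ->
  \int[leb]_x (k * f x) = k * \int[leb]_x f x.
Proof. by move=> mf f0 k0; rewrite ge0_integralZl. Qed.

Lemma lebesgue_integralD f g : measurable_fun setT f -> measurable_fun setT g ->
  (forall x, 0 <= f x) -> (forall x, 0 <= g x) ->
  \int[leb]_x (f x + g x) = \int[leb]_x f x + \int[leb]_x g x.
Proof. by move=> mf mg f0 g0; rewrite ge0_integralD. Qed.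

Lemma lebesgue_le_integral f g : measurable_fun setT f -> measurable_fun setT g ->
  (forall x, 0 <= f x) -> (forall x, f x <= g x) ->
  \int[leb]_x f x <= \int[leb]_x g x.
Proof. by move=> mf mg f0 fg; apply: ge0_le_integral. Qed.

Lemma sigma_finite_lebesgue : sigma_finite setT leb.
Proof. exact: (@sigma_finiteT _ _ _ leb). Qed.

Lemma lebesgue_tonelli d (T : measurableType d) (m : {measure set T -> \bar R})
    (F : T * R -> \bar R) :
  sigma_finite setT m -> measurable_fun setT F -> (forall z, 0 <= F z) ->
  \int[leb]_x \int[m]_y F (y, x) = \int[m]_y \int[leb]_x F (y, x).
Proof.
move=> sm mF F0; symmetry.
pose F' (z : T * measurableTypeR R) : \bar R := F z.
have mF' : measurable_fun setT F' by exact: mF.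
by apply: (sigma_finite_tonelli mF' F0) => //; exact: sigma_finite_lebesgue.
Qed.

Lemma lebesgue_measurable_integral d (T : measurableType d)
    (m : {measure set T -> \bar R}) (F : T * R -> \bar R) :
  sigma_finite setT m -> measurable_fun setT F -> (forall z, 0 <= F z) ->
  measurable_fun setT (fun x : R => \int[m]_y F (y, x)).
Proof.
move=> sm mF F0.
pose F' (z : R * T) : \bar R := F (z.2, z.1).
have mF' : measurable_fun setT F'.
  by apply: (measurableT_comp mF); exact: measurable_swap.
exact: (sigma_finite_measurable_integral mF' (fun z => F0 _) sm).
Qed.

Lemma measurable_lebesgue_integral d (T : measurableType d)
    (F : T * R -> \bar R) : measurable_fun setT F -> (forall z, 0 <= F z) ->
  measurable_fun setT (fun y : T => \int[leb]_x F (y, x)).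
Proof.
move=> mF F0.
pose F' (z : T * measurableTypeR R) : \bar R := F z.
have mF' : measurable_fun setT F' by exact: mF.
exact: (sigma_finite_measurable_integral mF' F0 sigma_finite_lebesgue).
Qed.

End LebesgueChangeOfVariables.

(** * Truncated powers and the Gamma function *)

Section TruncatedPower.
Context {R : realType}.
Local Notation leb := (@lebesgue_measure R).
Implicit Types (a b t x : R).

(** The exponent is [a - 1], so that convolution adds the indices. *)
Definition tpow a t : R := if 0 < t then t `^ (a - 1) else 0.

Lemma tpow_ge0 a t : 0 <= tpow a t.
Proof. by rewrite /tpow; case: ifP => // _; exact: powR_ge0. Qed.

Lemma tpow_gt0E a t : 0 < t -> tpow a t = t `^ (a - 1).
Proof. by rewrite /tpow => ->. Qed.

Lemma tpow_le0 a t : t <= 0 -> tpow a t = 0.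
Proof. by rewrite /tpow ltNge => ->. Qed.

Lemma tpow1 t : tpow 1 t = (0 < t)%R%:R.
Proof. by rewrite /tpow subrr powRr0; case: ifP. Qed.

Lemma measurable_tpow a : measurable_fun setT (tpow a).
Proof.
apply: measurable_fun_ifT => //.
  exact: (@measurable_fun_ltr _ _ R setT (cst 0) id).
Qed.

Lemma tpowZ a c t : 0 < c -> tpow a (c * t) = c `^ (a - 1) * tpow a t.
Proof.
move=> c0; rewrite /tpow pmulr_rgt0//; case: ifPn => t0; last by rewrite mulr0.
by rewrite powRM// ltW.
Qed.

Lemma measurable_tpow_comp d (T : measurableType d) a (h : T -> R) :
  measurable_fun setT h -> measurable_fun setT (fun z => tpow a (h z)).
Proof. by move=> mh; apply: measurableT_comp mh; exact: measurable_tpow. Qed.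

Local Open Scope ereal_scope.

(** Extended-real versions of the Euler integrals: the identities between them
    are proved by Tonelli before any finiteness is known, and yield it. *)
Definition egamma a : \bar R := \int[leb]_t (tpow a t * expR (- t))%:E.

Definition ebeta a b : \bar R := \int[leb]_s (tpow a (1 - s) * tpow b s)%:E.

Lemma egamma_ge0 a : 0 <= egamma a.
Proof.
by apply: integral_ge0 => t _; rewrite lee_fin mulr_ge0 ?tpow_ge0 ?expR_ge0.
Qed.

Lemma ebeta_ge0 a b : 0 <= ebeta a b.
Proof. by apply: integral_ge0 => t _; rewrite lee_fin mulr_ge0 ?tpow_ge0. Qed.

Lemma measurable_tpow_conv a b x w :
  measurable_fun setT (fun s : R => (tpow a (x - s) * tpow b (s - w))%:E).
Proof.
apply/measurable_EFinP; apply: measurable_funM;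
  by apply: measurable_tpow_comp; apply: measurable_funB.
Qed.

Lemma measurable_tpow_conv0 a b x :
  measurable_fun setT (fun s : R => (tpow a (x - s) * tpow b s)%:E).
Proof.
by have := measurable_tpow_conv a b x 0; under eq_fun do rewrite subr0.
Qed.

(** Rescaling [s] to [x * s] extracts the power of [x]. *)
Lemma integral_tpow_conv a b x :
  \int[leb]_s (tpow a (x - s) * tpow b s)%:E = ebeta a b * (tpow (a + b) x)%:E.
Proof.
have [x0|x0] := leP x 0%R.
  rewrite (tpow_le0 _ x0) mule0 integral0_eq// => s _.
  have [s0|s0] := leP s 0%R; first by rewrite (tpow_le0 b)// mulr0.
  by rewrite tpow_le0 ?mul0r//; lra.
rewrite (integral_affine 0%R x0)//; last 2 first.
- exact: measurable_tpow_conv0.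
- by move=> s; rewrite lee_fin mulr_ge0 ?tpow_ge0.
transitivity (x%:E * \int[leb]_s ((x `^ (a - 1) * x `^ (b - 1))%:E *
    (tpow a (1 - s) * tpow b s)%:E)).
  congr (_ * _); apply: eq_integral => s _.
  have -> : (x - (x * s + 0) = x * (1 - s))%R by ring.
  rewrite addr0 !tpowZ// -EFinM; congr (_%:E); ring.
rewrite ge0_integralZl//; last 3 first.
- exact: measurable_tpow_conv0.
- by move=> s _; rewrite lee_fin mulr_ge0 ?tpow_ge0.
- by rewrite lee_fin mulr_ge0 ?powR_ge0.
rewrite muleA -EFinM muleC tpow_gt0E//; congr (_ * _%:E).
have -> : (a + b - 1 = 1 + ((a - 1) + (b - 1)))%R by ring.
by rewrite !powRD ?(gt_eqF x0) ?implybT// powRr1 ?ltW.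
Qed.

Lemma integral_tpow_conv_shift a b x w :
  \int[leb]_s (tpow a (x - s) * tpow b (s - w))%:E =
  ebeta a b * (tpow (a + b) (x - w))%:E.
Proof.
rewrite (integral_translation w)//.
- rewrite -integral_tpow_conv; apply: eq_integral => s _.
  by congr (tpow _ _ * tpow _ _)%:E; ring.
- exact: measurable_tpow_conv.
- by move=> s; rewrite lee_fin mulr_ge0 ?tpow_ge0.
Qed.

Lemma measurable_gamma_integrand a :
  measurable_fun setT (fun t => (tpow a t * expR (- t))%:E).
Proof.
apply/measurable_EFinP; apply: measurable_funM; first exact: measurable_tpow.
by apply: measurableT_comp => //; apply: measurableT_comp.
Qed.

(** Both sides are the double integral of
    [tpow a (x - s) * tpow b s * expR (- x)]: over [x] first, translated by [s],
    it is a product; over [s] first it is a convolution. *)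
Lemma egamma_beta a b : egamma a * egamma b = ebeta a b * egamma (a + b).
Proof.
pose F (z : R * R) : \bar R :=
  (tpow a (z.2 - z.1) * tpow b z.1 * expR (- z.2))%:E.
have mF : measurable_fun setT F.
  apply/measurable_EFinP; apply: measurable_funM.
    apply: measurable_funM; last exact: measurable_tpow_comp.
    by apply: measurable_tpow_comp; apply: measurable_funB.
  by apply: measurableT_comp => //; apply: measurableT_comp.
have F0 z : 0 <= F z by rewrite lee_fin !mulr_ge0 ?tpow_ge0 ?expR_ge0.
have mg c := measurable_gamma_integrand c.
have g0 c t : 0 <= (tpow c t * expR (- t))%:E.
  by rewrite lee_fin mulr_ge0 ?tpow_ge0 ?expR_ge0.
transitivity (\int[leb]_x \int[leb]_s F (s, x)).
  transitivity (\int[leb]_s \int[leb]_x F (s, x)); last first.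
    by symmetry; apply: lebesgue_tonelli => //; exact: sigma_finite_lebesgue.
  rewrite -lebesgue_integralZl ?egamma_ge0//.
  apply: eq_integral => s _; rewrite (integral_translation s)//; last first.
    by apply: measurableT_comp mF _.
  rewrite muleC -lebesgue_integralZl//.
  apply: eq_integral => x _; rewrite /F/= -EFinM addrK opprD expRD.
  by congr (_%:E); ring.
rewrite -lebesgue_integralZl ?ebeta_ge0//.
apply: eq_integral => x _.
transitivity (\int[leb]_s ((expR (- x))%:E * (tpow a (x - s) * tpow b s)%:E)).
  by apply: eq_integral => s _; rewrite /F/= -EFinM mulrC.
rewrite lebesgue_integralZl//.
- by rewrite integral_tpow_conv muleCA -EFinM mulrC.
- exact: measurable_tpow_conv0.
- by move=> s; rewrite lee_fin mulr_ge0 ?tpow_ge0.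
Qed.

(** The substitution [s = 1 / x] reduces the integral of a power near [0], where
    it is singular for [b < 1], to the tail of a power at infinity. *)
Lemma ebeta1 b : (0 < b)%R -> ebeta 1 b = (b^-1)%:E.
Proof.
move=> b0; rewrite /ebeta.
transitivity (\int[leb]_(s in `]0%R, +oo[) (tpow 1 (1 - s) * tpow b s)%:E).
  rewrite integral_oyE; apply: eq_integral => s _.
  by have [//|s0] := ltP 0%R s; rewrite (tpow_le0 b)// mulr0.
rewrite integral_inversion//; last 2 first.
- exact: measurable_tpow_conv0.
- by move=> s; rewrite lee_fin mulr_ge0 ?tpow_ge0.
transitivity (\int[leb]_(s in `]1%R, +oo[) (s `^ (- b - 1))%:E).
  rewrite !integral_oyE; apply: eq_integral => s _.
  have [s1|s1] := ltP 1%R s.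
    have s0 : (0 < s)%R by lra.
    rewrite s0 tpow1 subr_gt0 invf_lt1// s1 mul1r tpow_gt0E ?invr_gt0//.
    rewrite -EFinM; congr (_%:E).
    have -> : (- b - 1 = - 1 * (b - 1) - 2)%R by ring.
    by rewrite [in RHS]powRD ?(gt_eqF s0) ?implybT// powRrM powR_inv1 ?powR_invn// ltW.
  case: ifPn => // s0.
  by rewrite tpow1 subr_gt0 invf_lt1// ltNge s1/= mul0r mul0e.
rewrite integral_itv_obnd_cbnd; last first.
  by apply: measurable_funTS; apply/measurable_EFinP; exact: measurable_powR.
by rewrite integral_powR_tail// powR1 mul1r.
Qed.

Lemma egamma1 : egamma 1 = 1.
Proof.
rewrite -(@integral_exponential_pdf R 1 ltr01) /egamma.
transitivity (\int[leb]_(t in `]0%R, +oo[) (expR (- t))%:E).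
  rewrite integral_oyE; apply: eq_integral => t _.
  by rewrite tpow1; case: ifP; rewrite (mul1r, mul0r).
rewrite integral_itv_obnd_cbnd; last first.
  apply: measurable_funTS; apply/measurable_EFinP.
  by apply: measurableT_comp => //; apply: measurableT_comp.
rewrite integral_mkcond; apply: eq_integral => t _.
rewrite /exponential_pdf !patchE; case: ifP => // _.
by rewrite mul1r mulN1r.
Qed.

(** The case [a = 1] of the relation between Beta and Gamma functions. *)
Lemma egammaS a : (0 < a)%R -> egamma (1 + a) = a%:E * egamma a.
Proof.
move=> a0; have := egamma_beta 1 a; rewrite egamma1 mul1e ebeta1// => ->.
by rewrite muleA -EFinM mulfV ?gt_eqF// mul1e.
Qed.

(** For [a <= 1] the integrand is dominated by [tpow a] on [(0, 1)] and by
    [expR (- t)] beyond; the functional equation does the rest. *)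
Lemma egamma_lty a : (0 < a)%R -> egamma a < +oo.
Proof.
have pos (f g : R) : (0 <= f)%R -> (0 <= g)%R -> 0 <= (f * g)%:E.
  by move=> f0 g0; rewrite lee_fin mulr_ge0.
have base c : (0 < c <= 1)%R -> egamma c < +oo.
  move=> /andP[c0 c1].
  apply: (@le_lt_trans _ _ (ebeta 1 c + egamma 1)); last first.
    by rewrite egamma1 ebeta1// -EFinD ltry.
  rewrite -lebesgue_integralD//; last 4 first.
  - exact: measurable_tpow_conv0.
  - exact: measurable_gamma_integrand.
  - by move=> t; rewrite pos ?tpow_ge0.
  - by move=> t; rewrite pos ?tpow_ge0 ?expR_ge0.
  apply: lebesgue_le_integral.
  - exact: measurable_gamma_integrand.
  - apply: emeasurable_funD; first exact: measurable_tpow_conv0.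
    exact: measurable_gamma_integrand.
  - by move=> t; rewrite pos ?tpow_ge0 ?expR_ge0.
  - move=> t; rewrite -EFinD lee_fin !tpow1 subr_gt0.
    have [t0|t0] := leP t 0%R.
      by rewrite !(tpow_le0 c)// !mul0r mulr0 addr0.
    have [t1|t1] := ltP t 1%R.
      rewrite mul1r ler_wpDr ?mulr_ge0 ?expR_ge0// ler_piMr ?tpow_ge0//.
      by rewrite -expR0 ler_expR; lra.
    rewrite mul0r add0r mul1r ler_piMl ?expR_ge0// tpow_gt0E//.
    by rewrite -[leRHS](powRr0 t); apply: ler_powR => //; lra.
suff H n c : (0 < c <= n.+1%:R)%R -> egamma c < +oo.
  move=> a0; apply: (H (Num.truncn a)); rewrite a0 ltW// truncnS_gt//.
elim: n c => [|n IH] c /andP[c0 cn]; first by apply: base; rewrite c0.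
have [c1|c1] := leP c 1%R; first by apply: base; rewrite c0.
have -> : c = (1 + (c - 1))%R by ring.
rewrite egammaS ?subr_gt0//; apply: lte_mul_pinfty => //.
  by rewrite lee_fin; lra.
by apply: IH; rewrite subr_gt0 c1 lerBlDr natr1.
Qed.

Lemma egamma_gt0 a : (0 < a)%R -> 0 < egamma a.
Proof.
move=> a0; apply: (@lt_le_trans _ _ ((expR (-1))%:E * ebeta 1 a)).
  by rewrite ebeta1// -EFinM lte_fin mulr_gt0 ?expR_gt0 ?invr_gt0.
rewrite -lebesgue_integralZl//; last 2 first.
- exact: measurable_tpow_conv0.
- by move=> t; rewrite lee_fin mulr_ge0 ?tpow_ge0.
apply: lebesgue_le_integral.
- by apply: emeasurable_funM => //; exact: measurable_tpow_conv0.
- exact: measurable_gamma_integrand.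
- by move=> t; rewrite -EFinM lee_fin !mulr_ge0 ?tpow_ge0 ?expR_ge0.
- move=> t; rewrite -EFinM lee_fin tpow1 subr_gt0.
  have [t1|t1] := ltP t 1%R; last first.
    by rewrite mul0r mulr0 mulr_ge0 ?tpow_ge0 ?expR_ge0.
  by rewrite mul1r mulrC ler_wpM2l ?tpow_ge0// ler_expR lerN2 ltW.
Qed.

Lemma EFin_Gamma a : (0 < a)%R -> (Gamma a)%:E = egamma a.
Proof.
move=> a0; rewrite /Gamma /Rintegral.
have -> : \int[leb]_(t in `]0%R, +oo[) (t `^ (a - 1) * expR (- t))%:E = egamma a.
  rewrite integral_oyE; apply: eq_integral => t _.
  by rewrite /tpow; case: ifP => // _; rewrite mul0r.
by rewrite fineK// ge0_fin_numE ?egamma_ge0// egamma_lty.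
Qed.

Lemma Gamma_gt0 a : (0 < a)%R -> (0 < Gamma a)%R.
Proof. by move=> a0; rewrite -lte_fin EFin_Gamma// egamma_gt0. Qed.

Lemma GammaS a : (0 < a)%R -> Gamma (1 + a) = (a * Gamma a)%R.
Proof.
move=> a0; apply: EFin_inj; rewrite EFinM !EFin_Gamma ?egammaS//; lra.
Qed.

Lemma Gamma_natS n : Gamma (n%:R + 1 : R) = n`!%:R.
Proof.
elim: n => [|n IH].
  by apply: EFin_inj; rewrite add0r EFin_Gamma// egamma1.
by rewrite -natr1 addrC GammaS// IH factS natrM natr1.
Qed.

Lemma ebetaE a b : (0 < a)%R -> (0 < b)%R ->
  ebeta a b = (Gamma a * Gamma b / Gamma (a + b))%:E.
Proof.
move=> a0 b0; have ab0 : (0 < a + b)%R by lra.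
rewrite EFinM EFinM !EFin_Gamma// egamma_beta -EFin_Gamma// -muleA -EFinM.
by rewrite mulfV ?mule1// gt_eqF ?Gamma_gt0.
Qed.

End TruncatedPower.

(** * Derivatives from sandwiched increments *)

Section SandwichedDifferenceQuotient.
Context {R : realType}.
Variables F f : R -> R.
Hypothesis sandwich :
  forall a b, a <= b -> (b - a) * f a <= F b - F a <= (b - a) * f b.

(** The difference quotient between [x] and [x + h] lies between [f x] and
    [f (x + h)], in an order that depends on the sign of [h]. *)
Lemma sandwich_is_derive (x : R) :
  {for x, continuous f} -> is_derive x 1 F (f x).
Proof.
move=> cf.
have H : h^-1 *: (F (h *: 1 + x) - F x) @[h --> 0^'] --> f x.
  apply/cvgrPdist_le => e e0.
  have /cvgrPdist_le/(_ e e0) := cf.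
  move=> /nbhs_ballP[d /= d0 fd].
  near=> h.
  have h0 : h != 0 by near: h; exact: nbhs_dnbhs_neq.
  have hd : `|h| < d by near: h; apply: dnbhs0_lt.
  have : `|f x - f (x + h)| <= e.
    by apply: fd; rewrite /ball/= opprD addrA subrr add0r normrN.
  rewrite /GRing.scale/= mulr1 (addrC h).
  set q := h^-1 * _; suff : f x <= q <= f (x + h) \/ f (x + h) <= q <= f x.
    by rewrite !ler_norml; lra.
  have [hp|hn] := ltP 0 h; [left|right].
    have /sandwich : x <= x + h by rewrite lerDl ltW.
    by rewrite (_ : x + h - x = h); [rewrite /q ler_pdivlMl// ler_pdivrMl|ring].
  have {h0}hn : 0 < - h by rewrite oppr_gt0 lt_neqAle h0.
  have /sandwich : x + h <= x by lra.
  have -> : q = (- h)^-1 * (F x - F (x + h)) by rewrite invrN mulNr -mulrN opprB.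
  by rewrite (_ : x - (x + h) = - h); [rewrite ler_pdivlMl// ler_pdivrMl|ring].
have D : derivable F x 1 by apply/cvg_ex; exists (f x).
by split => //; apply/cvg_lim.
Unshelve. all: by end_near. Qed.

(** Near [x] the function [f] is bounded by its values at [x - 1] and [x + 1],
    hence [F] is Lipschitz there. *)
Lemma sandwich_continuous : {homo f : a b / a <= b} -> continuous F.
Proof.
move=> ndf x; pose C := `|f (x - 1)| + `|f (x + 1)|.
have fC (y : R) : x - 1 <= y <= x + 1 -> - C <= f y <= C.
  move=> /andP[/ndf h1 /ndf h2].
  have := ler_norm (f (x + 1)); have := ler_norm (- f (x - 1)).
  by rewrite normrN /C; have := normr_ge0 (f (x + 1));
    have := normr_ge0 (f (x - 1)); lra.
have FC a b : x - 1 <= a -> a <= b -> b <= x + 1 -> `|F b - F a| <= (b - a) * C.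
  move=> xa ab bx; have /andP[h1 h2] := sandwich ab.
  have /andP[fa _] := fC a (introT andP (conj xa (le_trans ab bx))).
  have /andP[_ fb] := fC b (introT andP (conj (le_trans xa ab) bx)).
  have ba : 0 <= b - a by lra.
  rewrite ler_norml; apply/andP; split.
    by apply: le_trans h1; rewrite -mulrN; exact: ler_wpM2l.
  by apply: (le_trans h2); exact: ler_wpM2l.
have C0 : 0 <= C by rewrite addr_ge0.
apply/cvgrPdist_le => e e0; near=> y.
have xy1 : `|x - y| <= 1.
  by near: y; apply: cvgr_dist_le => //; exact: cvg_id.
have xye : `|x - y| <= e / (C + 1).
  near: y; apply: cvgr_dist_le; first exact: cvg_id.
  by rewrite divr_gt0// ltr_wpDl.
have H : `|x - y| * C <= e.
  apply: (@le_trans _ _ (e / (C + 1) * C)); first exact: ler_wpM2r.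
  by rewrite mulrAC ler_pdivrMr ?ltr_wpDl// ler_wpM2l//; lra.
move: xy1; rewrite ler_norml => /andP[xy1 xy2].
apply: le_trans H; have [xy|xy] := leP x y.
  rewrite distrC [X in _ <= X * _]distrC [X in _ <= X * _]ger0_norm ?subr_ge0//.
  by apply: FC => //; lra.
rewrite [X in _ <= X * _]ger0_norm ?subr_ge0 ?(ltW xy)//.
by apply: FC; [lra|exact: ltW|lra].
Unshelve. all: by end_near. Qed.

End SandwichedDifferenceQuotient.

(** * Riemann-Liouville integrals of a locally finite measure *)

Lemma measurable_itvco_bool (R : realType) (a b : R) :
  measurable_fun setT (fun s : R => a <= s < b).
Proof.
apply: measurable_and.
  exact: (@measurable_fun_ler _ _ R setT (cst a) id).
exact: (@measurable_fun_ltr _ _ R setT id (cst b)).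
Qed.

Section IntegralOverInterval.
Context {R : realType}.
Local Notation leb := (@lebesgue_measure R).
Implicit Types a b : R.
Local Open Scope ereal_scope.

Lemma integral_cst_itv (k : \bar R) a b : 0 <= k -> (a <= b)%R ->
  \int[leb]_s (if (a <= s < b)%R then k else 0) = (b - a)%:E * k.
Proof.
move=> k0 ab.
rewrite -(@integral_boolE _ _ _ leb `[a, b[%classic); last first.
  by move=> s; rewrite /= in_itv/=.
rewrite integral_cst// [X in _ * X](lebesgue_measure_itv `[a, b[)/= lte_fin muleC.
case: ltP => [//|ba]; have -> : a = b by apply: le_anti; rewrite ab ba.
by rewrite subrr mul0e.
Qed.

Lemma integral_homo_itv (g : R -> \bar R) a b :
  measurable_fun setT g -> (forall s, 0 <= g s) ->
  {homo g : x y / (x <= y)%R >-> x <= y} -> (a <= b)%R ->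
  (b - a)%:E * g a <= \int[leb]_s (if (a <= s < b)%R then g s else 0) /\
  \int[leb]_s (if (a <= s < b)%R then g s else 0) <= (b - a)%:E * g b.
Proof.
move=> mg g0 ndg ab.
have mI (f : R -> \bar R) : measurable_fun setT f ->
    measurable_fun setT (fun s => if (a <= s < b)%R then f s else 0).
  by move=> mf; apply: measurable_fun_ifT => //; exact: measurable_itvco_bool.
have I0 (f : R -> \bar R) : (forall s, 0 <= f s) ->
    forall s, 0 <= (if (a <= s < b)%R then f s else 0).
  by move=> f0 s; case: ifP.
rewrite -(integral_cst_itv (g0 a) ab) -(integral_cst_itv (g0 b) ab).
split; apply: lebesgue_le_integral.
- exact: (mI (cst (g a))).
- exact: mI.
- by apply: (I0 (cst (g a))) => s; exact: g0.
- by move=> s; case: ifP => [/andP[as_ _]|_]; [exact: ndg|exact: lexx].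
- exact: mI.
- exact: (mI (cst (g b))).
- exact: I0.
- by move=> s; case: ifP => [/andP[_ /ltW sb]|_]; [exact: ndg|exact: lexx].
Qed.

End IntegralOverInterval.

Section RiemannLiouville.
Context {R : realType}.
Local Notation leb := (@lebesgue_measure R).
Variable rho : {measure set R -> \bar R}.
Hypothesis rho_lt0 : rho `]-oo, 0[%classic = 0%E.
Hypothesis rho_lty : forall x : R, (rho `]-oo, x[%classic < +oo)%E.
Local Open Scope ereal_scope.

Lemma sigma_finite_locally_finite : sigma_finite setT rho.
Proof.
exists (fun n => `]-oo, n%:R[%classic : set R); last by move=> n; split.
apply/seteqP; split=> // x _; exists (Num.truncn `|x|).+1 => //=.
by rewrite in_itv/= (le_lt_trans (ler_norm x))// truncnS_gt.
Qed.
Let sf := sigma_finite_locally_finite.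

(** The Riemann-Liouville integral of order [a] of [rho], without the factor
    [1 / Gamma a]. *)
Definition RL (a x : R) : \bar R := \int[rho]_w (tpow a (x - w))%:E.

Let kernel a (z : R * R) : \bar R := (tpow a (z.2 - z.1))%:E.

Let measurable_kernel a : measurable_fun setT (kernel a).
Proof.
apply/measurable_EFinP; apply: measurable_tpow_comp.
by apply: measurable_funB.
Qed.

Lemma measurable_RL a : measurable_fun setT (RL a).
Proof.
apply: (@lebesgue_measurable_integral _ _ _ rho (kernel a)) => // z.
by rewrite lee_fin tpow_ge0.
Qed.

Lemma RL_ge0 a x : 0 <= RL a x.
Proof. by apply: integral_ge0 => w _; rewrite lee_fin tpow_ge0. Qed.

(** By Tonelli, the semigroup law of truncated powers passes to their
    convolutions with [rho]. *)
Lemma RL_semigroup a b x :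
  \int[leb]_s ((tpow a (x - s))%:E * RL b s) = ebeta a b * RL (a + b) x.
Proof.
pose F (z : R * R) : \bar R := (tpow a (x - z.2) * tpow b (z.2 - z.1))%:E.
have mF : measurable_fun setT F.
  by apply/measurable_EFinP; apply: measurable_funM; apply: measurable_tpow_comp;
    apply: measurable_funB.
have F0 z : 0 <= F z by rewrite lee_fin mulr_ge0 ?tpow_ge0.
have mt c y : measurable_fun setT (fun w : R => (tpow c (y - w))%:E).
  by apply/measurable_EFinP; apply: measurable_tpow_comp; apply: measurable_funB.
transitivity (\int[leb]_s \int[rho]_w F (w, s)).
  apply: eq_integral => s _; rewrite -ge0_integralZl//.
  - by move=> w _; rewrite lee_fin tpow_ge0.
  - by rewrite lee_fin tpow_ge0.
rewrite lebesgue_tonelli// -ge0_integralZl ?ebeta_ge0//.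
  by apply: eq_integral => w _; rewrite -integral_tpow_conv_shift.
by move=> w _; rewrite lee_fin tpow_ge0.
Qed.

Lemma RL1 x : RL 1 x = rho `]-oo, x[%classic.
Proof.
rewrite /RL -[RHS]mul1e -integral_cst//.
rewrite (@integral_boolE _ _ _ rho _ (fun w => (w < x)%R)).
  by apply: eq_integral => w _; rewrite tpow1 subr_gt0; case: ifP.
by move=> w; rewrite /= in_itv/=.
Qed.

Lemma RL_le0 a x : (x <= 0)%R -> RL a x = 0.
Proof.
move=> x0; transitivity (\int[rho]_(w in `]-oo, x[) (tpow a (x - w))%:E).
  rewrite (@integral_boolE _ _ _ rho _ (fun w => (w < x)%R)).
    apply: eq_integral => w _; case: ltP => // xw.
    by rewrite tpow_le0// subr_le0.
  by move=> w; rewrite /= in_itv/=.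
apply: null_set_integral => //.
- apply: measurable_funTS; apply/measurable_EFinP.
  by apply: measurable_tpow_comp; apply: measurable_funB.
- apply/eqP; rewrite eq_le measure_ge0 andbT -rho_lt0.
  apply: le_measure; rewrite ?inE// => w /=; rewrite !in_itv/=; lra.
Qed.

Lemma RL_homo a x y : (1 <= a)%R -> (x <= y)%R -> RL a x <= RL a y.
Proof.
move=> a1 xy; apply: ge0_le_integral => //.
- by move=> w _; rewrite lee_fin tpow_ge0.
- by apply/measurable_EFinP; apply: measurable_tpow_comp; apply: measurable_funB.
- by apply/measurable_EFinP; apply: measurable_tpow_comp; apply: measurable_funB.
- move=> w _; rewrite lee_fin.
  have [xw|xw] := leP x w; first by rewrite tpow_le0 ?tpow_ge0// subr_le0.
  rewrite !tpow_gt0E ?subr_gt0//; last exact: lt_le_trans xy.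
  by rewrite ge0_ler_powR ?nnegrE//; lra.
Qed.

(** Normalised so that each function is the integral of the previous one. *)
Definition eRLn n x : \bar R := (n`!%:R^-1)%:E * RL (n%:R + 1) x.

Lemma eRLn_ge0 n x : 0 <= eRLn n x.
Proof. by rewrite mule_ge0 ?RL_ge0// lee_fin. Qed.

Lemma measurable_eRLn n : measurable_fun setT (eRLn n).
Proof. by apply: emeasurable_funM => //; exact: measurable_RL. Qed.

Lemma eRLn0 x : eRLn 0 x = rho `]-oo, x[%classic.
Proof. by rewrite /eRLn invr1 mul1e add0r RL1. Qed.

Lemma eRLn_le0 n x : (x <= 0)%R -> eRLn n x = 0.
Proof. by move=> x0; rewrite /eRLn RL_le0// mule0. Qed.

Lemma eRLn_homo n x y : (x <= y)%R -> eRLn n x <= eRLn n y.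
Proof.
move=> xy; apply: lee_wpmul2l; first by rewrite lee_fin.
by apply: RL_homo => //; rewrite lerDr.
Qed.

(** The semigroup law with [a = 1]: the factor [ebeta 1 n.+1 = 1 / n.+1] is what
    turns [1 / n!] into [1 / (n.+1)!]. *)
Lemma eRLnS n x : eRLn n.+1 x = \int[leb]_s ((tpow 1 (x - s))%:E * eRLn n s).
Proof.
under eq_integral do rewrite /eRLn muleCA.
rewrite lebesgue_integralZl//.
- rewrite RL_semigroup ebeta1 ?ltr_wpDl// muleA -EFinM /eRLn.
  rewrite -natr1 (addrC 1%R) -invfM natr1 -natrM factS.
  by rewrite mulnC.
- apply: emeasurable_funM; last exact: measurable_RL.
  by apply/measurable_EFinP; apply: measurable_tpow_comp; apply: measurable_funB.
- by move=> s; rewrite mule_ge0 ?RL_ge0// lee_fin tpow_ge0.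
Qed.

#[local] Opaque eRLn.

Lemma eRLn_increment n a b : (a <= b)%R ->
  eRLn n.+1 b = eRLn n.+1 a + \int[leb]_s (if (a <= s < b)%R then eRLn n s else 0).
Proof.
move=> ab; rewrite !eRLnS -lebesgue_integralD.
- apply: eq_integral => s _; rewrite !tpow1 !subr_gt0.
  have [sa|sa] := ltP s a.
    by rewrite (lt_le_trans sa ab) mul1e adde0.
  by rewrite mul0e add0e andTb; case: (s < b)%R; rewrite (mul1e, mul0e).
- apply: emeasurable_funM; last exact: measurable_eRLn.
  by apply/measurable_EFinP; apply: measurable_tpow_comp; apply: measurable_funB.
- apply: measurable_fun_ifT => //; last exact: measurable_eRLn.
  exact: measurable_itvco_bool.
- by move=> s; rewrite mule_ge0 ?eRLn_ge0// lee_fin tpow_ge0.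
- by move=> s; case: ifP => // _; exact: eRLn_ge0.
Qed.

Lemma eRLn_increment_le n a b : (a <= b)%R ->
  eRLn n.+1 a + (b - a)%:E * eRLn n a <= eRLn n.+1 b /\
  eRLn n.+1 b <= eRLn n.+1 a + (b - a)%:E * eRLn n b.
Proof.
move=> ab; have [h1 h2] := @integral_homo_itv R (eRLn n) a b
  (measurable_eRLn n) (eRLn_ge0 n) (@eRLn_homo n) ab.
have incr := eRLn_increment n ab.
split; first by rewrite [X in _ <= X]incr; exact: leeD2l.
by rewrite [X in X <= _]incr; exact: leeD2l.
Qed.

(** As [eRLn n.+1] vanishes at [0], its value at [x] is at most
    [x * eRLn n x]; for [n = 0] this is local finiteness. *)
Lemma eRLn_fin_num n x : eRLn n x \is a fin_num.
Proof.
rewrite ge0_fin_numE ?eRLn_ge0//.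
elim: n x => [|n IH] x; first by rewrite eRLn0.
have [x0|/ltW x0] := leP x 0%R; first by rewrite eRLn_le0.
have [_] := eRLn_increment_le n x0; rewrite (eRLn_le0 n.+1 (lexx 0%R)) add0e => h.
apply: le_lt_trans h _; apply: lte_mul_pinfty => //.
by rewrite lee_fin subr0.
Qed.

Definition RLn n x : R := fine (eRLn n x).

Lemma EFin_RLn n x : (RLn n x)%:E = eRLn n x.
Proof. by rewrite fineK// eRLn_fin_num. Qed.

Lemma RLn_homo n : {homo RLn n : x y / (x <= y)%R}.
Proof.
move=> x y xy; apply: fine_le; [exact: eRLn_fin_num|exact: eRLn_fin_num|].
exact: eRLn_homo.
Qed.

Local Close Scope ereal_scope.

Lemma RLn_sandwich n a b : a <= b ->
  (b - a) * RLn n a <= RLn n.+1 b - RLn n.+1 a <= (b - a) * RLn n b.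
Proof.
move=> ab; move: (EFin_RLn n a) (EFin_RLn n b) (EFin_RLn n.+1 a)
  (EFin_RLn n.+1 b) (eRLn_increment_le n ab) => <- <- <- <-.
move: (RLn n a) (RLn n b) (RLn n.+1 a) (RLn n.+1 b) => p q r s [].
by rewrite -!EFinM -!EFinD !lee_fin lerBrDl lerBlDl => -> ->.
Qed.

Lemma RLnS_continuous n : continuous (RLn n.+1).
Proof. by apply: (sandwich_continuous (@RLn_sandwich n)); exact: RLn_homo. Qed.

(** [RLn 0] is monotone, so it suffices to approach [x] along one sequence on
    each side; there continuity of [rho] along monotone sequences of half-lines
    applies, and the right limit differs from the value by the mass of [x]. *)
Lemma RLn0_continuous x : rho [set x] = 0%E -> {for x, continuous (RLn 0)}.
Proof.
move=> rx.
have toR (u : nat -> R) (A : nat -> set R) :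
    (forall n, A n = `]-oo, (u n)[%classic) ->
    rho (A n) @[n --> \oo] --> rho `]-oo, x[%classic ->
    RLn 0 (u n) @[n --> \oo] --> RLn 0 x.
  move=> AE; rewrite -eRLn0 -EFin_RLn => /fine_cvg; apply: cvg_trans.
  by apply: near_eq_cvg; near=> n; rewrite /= AE -eRLn0.
have L : RLn 0 (x - n.+1%:R^-1) @[n --> \oo] --> RLn 0 x.
  apply: (toR _ (fun n => `]-oo, (x - n.+1%:R^-1)[%classic)) => //.
  have U : \bigcup_n `]-oo, (x - n.+1%:R^-1)[%classic = `]-oo, x[%classic :> set R.
    apply/seteqP; split=> y /=.
      by move=> [n _]; rewrite /= !in_itv/= => /lt_trans; apply; rewrite ltrBlDr ltrDl.
    rewrite in_itv/= => yx; exists (Num.truncn (x - y)^-1) => //=.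
    rewrite in_itv/= ltrBrDr -ltrBrDl.
    rewrite -[ltRHS]invrK ltf_pV2 ?posrE ?invr_gt0 ?subr_gt0//.
    exact: truncnS_gt.
  rewrite -U; apply: nondecreasing_cvg_mu => //.
    by rewrite U.
  move=> m n mn; apply/subsetPset => y /=; rewrite !in_itv/= => /lt_le_trans; apply.
  by rewrite lerB// lef_pV2 ?posrE// ler_nat.
have Rt : RLn 0 (x + n.+1%:R^-1) @[n --> \oo] --> RLn 0 x.
  apply: (toR _ (fun n => `]-oo, (x + n.+1%:R^-1)[%classic)) => //.
  have I : \bigcap_n `]-oo, (x + n.+1%:R^-1)[%classic = `]-oo, x]%classic :> set R.
    apply/seteqP; split=> y /=.
      move=> H; rewrite in_itv/= leNgt; apply/negP => xy.
      have /= := H (Num.truncn (y - x)^-1) Logic.I.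
      rewrite in_itv/= -ltrBlDl ltNge => /negP; apply.
      rewrite -[leRHS]invrK lef_pV2 ?posrE ?invr_gt0 ?subr_gt0//.
      by rewrite ltW// truncnS_gt.
    by rewrite in_itv/= => yx n _ /=; rewrite in_itv/= (le_lt_trans yx)// ltrDl.
  have -> : rho `]-oo, x[%classic = rho `]-oo, x]%classic.
    rewrite -(@setUitv1 _ _ _ _ true)// measureU//=; last first.
      apply/seteqP; split=> // y [] /=; rewrite in_itv/= => yx yE.
      by move: yx; rewrite yE ltxx.
    by rewrite rx adde0.
  rewrite -I; apply: nonincreasing_cvg_mu => //.
    by rewrite I.
  move=> m n mn; apply/subsetPset => y /=; rewrite !in_itv/= => /lt_le_trans; apply.
  by rewrite lerD2l lef_pV2 ?posrE// ler_nat.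
apply/cvgrPdist_le => e e0.
have /cvgrPdist_le/(_ e e0)[N _ HN] := L; have /cvgrPdist_le/(_ e e0)[M _ HM] := Rt.
have {HN} := HN N (leqnn N); have {HM} := HM M (leqnn M) => /=.
set d1 := M.+1%:R^-1; set d2 := N.+1%:R^-1 => h1 h2.
have d10 : 0 < d1 by rewrite invr_gt0.
have d20 : 0 < d2 by rewrite invr_gt0.
near=> y.
have y1 : y <= x + d1 by apply: ltW; near: y; apply: lt_nbhsl; rewrite ltrDl.
have y2 : x - d2 <= y by apply: ltW; near: y; apply: lt_nbhsr; rewrite ltrBlDr ltrDl.
have := RLn_homo 0 y1; have := RLn_homo 0 y2; move: h1 h2.
move: (RLn 0 x) (RLn 0 y) (RLn 0 (x + d1)) (RLn 0 (x - d2)) => p q r s.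
clear -R; rewrite !ler_norml => /andP[h1 _] /andP[_ h2] h3 h4.
by apply/andP; split; lra.
Unshelve. all: by end_near. Qed.

(** The sandwich applies where [RLn n] is continuous: everywhere for [n > 0], and
    outside the atoms for [n = 0]. *)
Lemma RLnS_is_derive n x : (0 < n)%N \/ rho [set x] = 0%E ->
  is_derive x 1 (RLn n.+1) (RLn n x).
Proof.
move=> nx; apply: (sandwich_is_derive (@RLn_sandwich n)).
case: nx => [|rx]; first by case: n => // n _; exact: RLnS_continuous.
by case: n => [|n]; [exact: RLn0_continuous|exact: RLnS_continuous].
Qed.

(** Stated so that applying [opD], which is differentiation in the variable
    [1 / x], lowers the index by one. *)
Lemma RLnS_inv_is_derive n x : 0 < x -> (0 < n)%N \/ rho [set x^-1] = 0%E ->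
  is_derive x 1 (fun t => RLn n.+1 t^-1) (- x ^- 2 * RLn n x^-1).
Proof.
move=> x0 /RLnS_is_derive D.
have Dinv : is_derive x 1 (fun t : R => t^-1) (- x ^- 2).
  have := @is_deriveV R id x 1 1 (lt0r_neq0 x0) (is_derive_id _ _).
  by rewrite /GRing.scale/= mulr1.
have := @is_derive1_comp R (RLn n.+1) (fun t => t^-1) x _ _ D Dinv.
by rewrite /GRing.scale/= mulrC.
Qed.

End RiemannLiouville.

(** * Inversion of the half-line *)

Section BooleanMeasurability.
Context {R : realType}.

Lemma measurable_fine_setT : measurable_fun setT (@fine R).
Proof. exact: (@fine_measurable R setT). Qed.

Lemma measurable_powR_fine (p : R) :
  measurable_fun setT (fun t : \bar R => fine t `^ p).
Proof.
exact: (measurableT_comp (@measurable_powR R p) measurable_fine_setT).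
Qed.

Lemma measurable_weight (p : R) :
  measurable_fun setT (fun t : \bar R => ((1 + fine t) `^ p)%:E).
Proof.
apply/measurable_EFinP; apply: (measurableT_comp (@measurable_powR R p)).
by apply: measurable_funD => //; exact: measurable_fine_setT.
Qed.

Lemma measurable_eitvoo_bool (a b : \bar R) :
  measurable_fun setT (fun t : \bar R => (a < t < b)%E).
Proof.
apply: measurable_and; apply: measurable_fun_lte => //.
Qed.

Lemma measurable_eitvco_bool (a b : \bar R) :
  measurable_fun setT (fun t : \bar R => (a <= t < b)%E).
Proof.
apply: measurable_and; [apply: measurable_fun_lee|apply: measurable_fun_lte] => //.
Qed.

Lemma measurable_bool_set d (T : measurableType d) (p : T -> bool) :
  measurable_fun setT p -> measurable [set x | p x].
Proof.
by move=> mp; have := mp measurableT [set true] Logic.I; rewrite setTI.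
Qed.

Lemma measurable_eitvoo (a b : \bar R) : measurable [set t : \bar R | (a < t < b)%E].
Proof. exact/measurable_bool_set/measurable_eitvoo_bool. Qed.

Lemma measurable_eitvco (a b : \bar R) : measurable [set t : \bar R | (a <= t < b)%E].
Proof. exact/measurable_bool_set/measurable_eitvco_bool. Qed.

End BooleanMeasurability.

Section InvertedMeasure.
Context {R : realType}.
Variable alpha : R.
Hypothesis alpha_gt0 : 0 < alpha.
Variable mu : {measure set (\bar R) -> \bar R}.
Local Open Scope ereal_scope.

(** [rho] is the image of [mu] under [t |-> 1 / t] with the weight
    [t `^ (- alpha)], where infinity goes to [0] with weight [1] and the points
    [t <= 0] are discarded.  The statement through integrals is equivalent and is
    the only form in which it is applied. *)
Definition represents_inversion (rho : {measure set R -> \bar R}) :=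
  forall f : R -> \bar R, measurable_fun setT f -> (forall x, 0 <= f x) ->
  \int[rho]_w f w = f 0%R * mu [set +oo] +
    \int[mu]_(t in [set t | 0 < t < +oo])
      (f (fine t)^-1%R * (fine t `^ (- alpha))%:E).

Lemma inverted_measure_exists : exists rho, represents_inversion rho.
Proof.
(* Both [fine +oo] and [0 `^ (-1)] are [0], so that [phi] maps [+oo] to [0]. *)
pose phi (t : \bar R) : R := (fine t `^ (-1))%R.
have mphi : measurable_fun setT phi by exact: measurable_powR_fine.
pose g (t : \bar R) : \bar R := if t == +oo then 1 else
  if 0 < t < +oo then (fine t `^ (- alpha))%:E else 0.
have mg : measurable_fun setT g.
  apply: measurable_fun_ifT => //; first exact: measurable_fun_eqe.
  apply: measurable_fun_ifT => //; first exact: measurable_eitvoo_bool.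
  by apply/measurable_EFinP; exact: measurable_powR_fine.
have g0 t : 0 <= g t.
  rewrite /g; case: ifP => // _; case: ifP => // _.
  by rewrite lee_fin powR_ge0.
have [rho rhoE] := @image_density_exists _ _ _ _ R mu phi g mphi mg g0.
exists rho => f mf f0.
rewrite (@integral_image_density _ _ _ _ R mu phi g mphi mg g0 rho (fun A _ => rhoE A))//.
rewrite preimage_setT.
transitivity (\int[mu]_t ((if t == +oo then f 0%R else 0) +
  (if 0 < t < +oo then f (fine t)^-1%R * (fine t `^ (- alpha))%:E else 0))).
  apply: eq_integral => t _; rewrite /g /phi.
  case: t => [r| |]; rewrite ?eqxx ?ltxx ?andbF ?ltNyr /=.
  - rewrite lte_fin ltry andbT add0e; case: ifPn => [r0|_]; last by rewrite mule0.
    by rewrite powR_inv1// ltW.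
  - by rewrite mule1 powR0 ?adde0// oppr_eq0 oner_eq0.
  - by rewrite mule0 add0e.
rewrite ge0_integralD//.
- congr (_ + _).
    rewrite -(@integral_boolE _ _ _ mu [set +oo] _ (fun=> f 0%R)); last first.
      by move=> t; split=> [->|/eqP].
    by rewrite integral_cst.
  by symmetry; apply: integral_boolE.
- by move=> t _; case: ifP => _; [exact: f0|exact: lexx].
- by apply: measurable_fun_ifT => //; exact: measurable_fun_eqe.
- by move=> t _; case: ifP => _; [rewrite mule_ge0// lee_fin powR_ge0|exact: lexx].
- apply: (eq_measurable_fun (fun t => if 0 < t < +oo then
    f (phi t) * (fine t `^ (- alpha))%:E else 0)).
    move=> t _; case: ifPn => // /andP[t0 toy]; congr (f _ * _).
    by rewrite /phi powR_inv1// fine_ge0// ltW.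
  apply: measurable_fun_ifT => //; first exact: measurable_eitvoo_bool.
  apply: emeasurable_funM; first exact: (measurableT_comp mf mphi).
  by apply/measurable_EFinP; exact: measurable_powR_fine.
Qed.

Lemma measurable_inverted (f : R -> \bar R) : measurable_fun setT f ->
  measurable_fun [set t : \bar R | 0 < t < +oo]
    (fun t => f (fine t)^-1%R * (fine t `^ (- alpha))%:E).
Proof.
move=> mf.
apply: (eq_measurable_fun (fun t => f (fine t `^ (-1))%R * (fine t `^ (- alpha))%:E)).
  move=> t; rewrite inE/= => /andP[t0 toy]; congr (f _ * _).
  by rewrite powR_inv1// fine_ge0// ltW.
apply: measurable_funTS; apply: emeasurable_funM.
  by apply: (measurableT_comp mf); exact: measurable_powR_fine.
by apply/measurable_EFinP; exact: measurable_powR_fine.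
Qed.

Variable rho : {measure set R -> \bar R}.
Hypothesis rhoE : represents_inversion rho.
Hypothesis muM : classM alpha mu.

Lemma inverted_lt0 : rho `]-oo, 0%R[%classic = 0.
Proof.
rewrite -[LHS]mul1e -integral_cst//.
rewrite (@integral_boolE _ _ _ rho _ (fun w => (w < 0)%R)); last first.
  by move=> w; rewrite /= in_itv/=.
rewrite rhoE/=; last 2 first.
- apply: measurable_fun_ifT => //.
  exact: (@measurable_fun_ltr _ _ R setT id (cst 0%R)).
- by move=> w; case: ifP => _; [exact: lee01|exact: lexx].
rewrite ltxx mul0e add0e integral0_eq// => t /= /andP[t0 toy].
by rewrite invr_lt0 ltNge fine_ge0 ?mul0e// ltW.
Qed.

Lemma inverted_set1 (x : R) : (0 < x)%R -> mu [set x%:E] = 0 ->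
  rho [set x^-1%R] = 0.
Proof.
move=> x0 mux; rewrite -[LHS]mul1e -integral_cst//.
rewrite (@integral_boolE _ _ _ rho _ (fun w => (w == x^-1)%R)); last first.
  by move=> w; split=> [->|/eqP].
rewrite rhoE/=; last 2 first.
- by apply: measurable_fun_ifT => //; apply: measurable_fun_eqr.
- by move=> w; case: ifP => _; [exact: lee01|exact: lexx].
rewrite eq_sym invr_eq0 gt_eqF// mul0e add0e.
transitivity (\int[mu]_(t in [set x%:E]) (fine t `^ (- alpha))%:E).
  rewrite (@integral_boolE _ _ _ mu [set t | 0 < t < +oo] (fun t => 0 < t < +oo))//.
  rewrite (@integral_boolE _ _ _ mu [set x%:E] (fun t => t == x%:E)); last first.
    by move=> w; split=> [->|/eqP].
  apply: eq_integral => t _; case: ifPn => [/andP[t0 toy]|tF].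
    have tfin : t \is a fin_num by rewrite ge0_fin_numE// ltW.
    rewrite -(fineK tfin) eqe (inj_eq invr_inj) fineK//.
    by case: ifP; rewrite (mul1e, mul0e).
  by case: eqP => // tx; move: tF; rewrite tx lte_fin x0 ltry.
apply: null_set_integral => //.
by apply: measurable_funTS; apply/measurable_EFinP; exact: measurable_powR_fine.
Qed.

(** The points [w < x] come from the [t > 1 / x], for which [t `^ (- alpha)] is
    at most [(1 + x) `^ alpha * (1 + t) `^ (- alpha)]: local finiteness of [rho]
    is the integrability condition on [mu]. *)
Lemma inverted_lty (x : R) : rho `]-oo, x[%classic < +oo.
Proof.
have [x0|x0] := leP x 0%R.
  apply: (@le_lt_trans _ _ (rho `]-oo, 0%R[%classic)); last by rewrite inverted_lt0.
  by apply: le_measure; rewrite ?inE// => w /=; rewrite !in_itv/=; lra.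
rewrite -[ltLHS]mul1e -integral_cst//.
rewrite (@integral_boolE _ _ _ rho _ (fun w => (w < x)%R)); last first.
  by move=> w; rewrite /= in_itv/=.
have mI : measurable_fun setT (fun w : R => (if (w < x)%R then 1 else 0) : \bar R).
  apply: measurable_fun_ifT => //.
  exact: (@measurable_fun_ltr _ _ R setT id (cst x)).
rewrite rhoE//=; last by move=> w; case: ifP => _; [exact: lee01|exact: lexx].
have [_ muf muoo] := muM.
rewrite x0 mul1e lte_add_pinfty//.
apply: (@le_lt_trans _ _ (\int[mu]_(t in [set t | 0 <= t < +oo])
    (((1 + x) `^ alpha)%:E * ((1 + fine t) `^ (- alpha))%:E))); last first.
  rewrite ge0_integralZl//.
  - by rewrite lte_mul_pinfty// lee_fin powR_ge0.
  - exact: measurable_eitvco.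
  - by apply: measurable_funTS; exact: measurable_weight.
  - by move=> t _; rewrite lee_fin powR_ge0.
  - by rewrite lee_fin powR_ge0.
have mG : measurable_fun setT (fun t : \bar R =>
    ((1 + x) `^ alpha)%:E * ((1 + fine t) `^ (- alpha))%:E).
  by apply: emeasurable_funM => //; exact: measurable_weight.
have G0 t : 0 <= ((1 + x) `^ alpha)%:E * ((1 + fine t) `^ (- alpha))%:E.
  by rewrite mule_ge0 ?lee_fin ?powR_ge0.
apply: (@le_trans _ _ (\int[mu]_(t in [set t | 0 < t < +oo])
    (((1 + x) `^ alpha)%:E * ((1 + fine t) `^ (- alpha))%:E))).
  apply: ge0_le_integral.
  - exact: measurable_eitvoo.
  - by move=> t _; rewrite mule_ge0 ?lee_fin ?powR_ge0//; case: ifP.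
  - exact: measurable_inverted mI.
  - exact: measurable_funTS.
  - move=> t /= /andP[t0 toy].
    case: ifPn => xt; last by rewrite mul0e.
    rewrite mul1e -EFinM lee_fin.
    have {}t0 : (0 < fine t)%R by rewrite fine_gt0// t0.
    rewrite !powRN ler_pdivlMr ?powR_gt0//; last by rewrite ltr_wpDr// ltW.
    rewrite mulrC ler_pdivrMr ?powR_gt0// -powRM ?addr_ge0 ?(ltW x0) ?(ltW t0)//.
    rewrite ge0_ler_powR ?(ltW alpha_gt0)// ?nnegrE ?mulr_ge0 ?addr_ge0 ?(ltW x0) ?(ltW t0)//.
    have : (1 < x * fine t)%R by rewrite -ltr_pdivrMr// mul1r.
    lra.
apply: ge0_subset_integral => //.
- exact: measurable_eitvoo.
- exact: measurable_eitvco.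
- exact: measurable_funTS.
- by move=> t /= /andP[/ltW -> ->].
Qed.

Lemma inverted_RLE (a x : R) : RL rho a x = (tpow a x)%:E * mu [set +oo] +
  \int[mu]_(t in [set t | 0 < t < +oo])
    ((tpow a (x - (fine t)^-1))%:E * (fine t `^ (- alpha))%:E).
Proof.
rewrite /RL rhoE ?subr0//.
- apply/measurable_EFinP; apply: measurable_tpow_comp; exact: measurable_funB.
- by move=> w; rewrite lee_fin tpow_ge0.
Qed.

(** This identity exchanges kernels of the form [(t - y) `^ (a - 1)] with
    convolution kernels in the inverted variables. *)
Lemma tpow_sub_inv (a y t : R) : (0 < y)%R -> (0 < t)%R ->
  (tpow a (y^-1 - t^-1) = (y * t) `^ (1 - a) * tpow a (t - y))%R.
Proof.
move=> y0 t0.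
have -> : (y^-1 - t^-1 = (y * t)^-1 * (t - y))%R.
  by field; rewrite !gt_eqF.
have yt0 : (0 < y * t)%R by rewrite mulr_gt0.
rewrite tpowZ ?invr_gt0//; congr (_ * _)%R.
by rewrite -powR_inv1 ?(ltW yt0)// -powRrM mulN1r opprB.
Qed.

Lemma kober_erdelyi_inner (a y : R) : (0 < y)%R ->
  \int[mu]_(u in [set u | y%:E < u < +oo])
    ((fine u `^ (a + alpha - 1) * (fine u - y) `^ (1 - a))^-1)%:E
  + mu [set +oo] = (y `^ (a - 1))%:E * RL rho a (y^-1)%R.
Proof.
move=> y0; rewrite inverted_RLE ge0_muleDr; last 2 first.
- by rewrite mule_ge0// lee_fin tpow_ge0.
- by apply: integral_ge0 => t _; rewrite mule_ge0// lee_fin ?tpow_ge0 ?powR_ge0.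
rewrite addeC; congr (_ + _).
  rewrite muleA -EFinM tpow_gt0E ?invr_gt0// -powRM ?invr_ge0 ?(ltW y0)//.
  by rewrite mulfV ?gt_eqF// powR1 mul1e.
rewrite -ge0_integralZl; last 4 first.
- exact: measurable_eitvoo.
- apply: (@measurable_inverted (fun w => (tpow a (y^-1 - w))%:E)).
  by apply/measurable_EFinP; apply: measurable_tpow_comp; exact: measurable_funB.
- by move=> t _; rewrite mule_ge0// lee_fin ?tpow_ge0 ?powR_ge0.
- by rewrite lee_fin powR_ge0.
rewrite (@integral_boolE _ _ _ mu [set u | y%:E < u < +oo] (fun u => y%:E < u < +oo))//.
rewrite (@integral_boolE _ _ _ mu [set t | 0 < t < +oo] (fun t => 0 < t < +oo))//.
apply: eq_integral => t _.
case: t => [t| |]; rewrite ?ltxx ?andbF// !lte_fin ltry !andbT/=.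
have [t0|t0] := ltP 0%R t; last first.
  by case: ifPn => //; rewrite ltNge (le_trans t0 (ltW y0)).
rewrite tpow_sub_inv// -!EFinM.
have [yt|ty] := ltP y t; last by rewrite tpow_le0 ?mulr0 ?mul0r ?mulr0// subr_le0.
rewrite tpow_gt0E ?subr_gt0//; congr (_%:E).
rewrite powRM ?ltW// invfM -!powRN.
have -> : (y `^ (a - 1) * (y `^ (1 - a) * t `^ (1 - a) * (t - y) `^ (a - 1) * t `^ (- alpha)) =
  (y `^ (a - 1) * y `^ (1 - a)) * (t `^ (1 - a) * t `^ (- alpha)) * (t - y) `^ (a - 1))%R by ring.
rewrite -!powRD ?(gt_eqF y0) ?(gt_eqF t0) ?implybT//.
have -> : (a - 1 + (1 - a) = 0)%R by ring.
rewrite powRr0 mul1r; congr (_ `^ _ * _ `^ _)%R; ring.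
Qed.

Lemma integral_powR_itv (b : R) : (0 < b)%R ->
  \int[@lebesgue_measure R]_s (if (0 < s < b)%R then s `^ (alpha - 1) else 0%R)%:E =
  (b `^ alpha / alpha)%:E.
Proof.
move=> b0.
transitivity (\int[@lebesgue_measure R]_s (tpow 1 (b - s) * tpow alpha s)%:E).
  apply: eq_integral => s _; congr (_%:E); rewrite tpow1 /tpow subr_gt0.
  by case: (s < b)%R; case: (0 < s)%R; rewrite ?(mul1r, mul0r).
rewrite integral_tpow_conv ebeta1// -EFinM tpow_gt0E// mulrC.
by congr (_ `^ _ / _)%:E; ring.
Qed.

End InvertedMeasure.

(** * Integrals of a power times a Riemann-Liouville integral *)

Section CumulatedKernel.
Context {R : realType}.
Local Notation leb := (@lebesgue_measure R).
Variable alpha : R.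
Hypothesis alpha_gt0 : 0 < alpha.
Implicit Types a y w s t : R.

(** The integrand of [s `^ (alpha + a - 2) * RL rho a (1 / s)] over [0 < s < y] at
    the point [z = (w, s)], before integration of [w] against [rho]. *)
Definition ckernel a y (z : R * R) : R :=
  if 0 < z.2 < y then z.2 `^ (alpha + a - 2) * tpow a (z.2^-1 - z.1) else 0.

Lemma ckernel_ge0 a y z : 0 <= ckernel a y z.
Proof. by rewrite /ckernel; case: ifP => // _; rewrite mulr_ge0 ?powR_ge0 ?tpow_ge0. Qed.

Lemma measurable_itvoo_bool (c b : R) :
  measurable_fun setT (fun s : R => c < s < b).
Proof.
apply: measurable_and.
  exact: (@measurable_fun_ltr _ _ R setT (cst c) id).
exact: (@measurable_fun_ltr _ _ R setT id (cst b)).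
Qed.

Lemma measurable_ckernel a y : measurable_fun setT (EFin \o ckernel a y).
Proof.
apply/measurable_EFinP.
apply: (eq_measurable_fun (fun z : R * R => if 0 < z.2 < y then
    z.2 `^ (alpha + a - 2) * tpow a (z.2 `^ (-1) - z.1) else 0)).
  move=> z _; rewrite /ckernel; case: ifP => // /andP[z0 _].
  by rewrite powR_inv1// ltW.
have m2 : measurable_fun setT (snd : R * R -> R) by exact: measurable_snd.
apply: measurable_fun_ifT => //.
  exact: (measurableT_comp (measurable_itvoo_bool 0 y) m2).
apply: measurable_funM.
  exact: (measurableT_comp (@measurable_powR R _) m2).
apply: measurable_tpow_comp; apply: measurable_funB => //.
exact: (measurableT_comp (@measurable_powR R _) m2).
Qed.

Local Open Scope ereal_scope.

Definition cint a y w : \bar R := \int[leb]_s (ckernel a y (w, s))%:E.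

Lemma cint_ge0 a y w : 0 <= cint a y w.
Proof. by apply: integral_ge0 => s _; rewrite lee_fin ckernel_ge0. Qed.

Lemma measurable_cint a y : measurable_fun setT (cint a y).
Proof.
apply: (measurable_lebesgue_integral (measurable_ckernel a y)) => z.
by rewrite lee_fin ckernel_ge0.
Qed.

Lemma cint0 a y : (0 < y)%R -> cint a y 0 = (y `^ alpha / alpha)%:E.
Proof.
move=> y0; rewrite -integral_powR_itv//; apply: eq_integral => s _.
rewrite /ckernel/=; case: ifPn => // /andP[s0 _].
rewrite subr0 tpow_gt0E ?invr_gt0// -powR_inv1 ?(ltW s0)// -powRrM.
rewrite -powRD ?(gt_eqF s0) ?implybT//; congr (_ `^ _)%:E; ring.
Qed.

(** The integral [cint a y w] in the original variable [t = 1 / w], up to a power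
    of [t]. *)
Definition cweight a y t : \bar R := \int[leb]_s
  (if (0 < s < y)%R then tpow a (t - s) * tpow alpha s else 0%R)%:E.

Lemma measurable_cweight_integrand a y t : measurable_fun setT (fun s : R =>
  (if (0 < s < y)%R then tpow a (t - s) * tpow alpha s else 0%R)%:E).
Proof.
apply/measurable_EFinP; apply: measurable_fun_ifT => //.
  exact: measurable_itvoo_bool.
apply: measurable_funM; last exact: measurable_tpow.
by apply: measurable_tpow_comp; exact: measurable_funB.
Qed.

Lemma cweight_integrand_ge0 a y t s :
  0 <= (if (0 < s < y)%R then tpow a (t - s) * tpow alpha s else 0%R)%:E.
Proof. by rewrite lee_fin; case: ifP => // _; rewrite mulr_ge0 ?tpow_ge0. Qed.

Lemma cintV a y t : (0 < t)%R ->
  cint a y (t^-1)%R * (t `^ (- alpha))%:E =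
  (t `^ (1 - a - alpha))%:E * cweight a y t.
Proof.
move=> t0; rewrite /cint.
transitivity (\int[leb]_s ((t `^ (1 - a))%:E *
  (if (0 < s < y)%R then tpow a (t - s) * tpow alpha s else 0%R)%:E) *
  (t `^ (- alpha))%:E).
  congr (_ * _); apply: eq_integral => s _; rewrite /ckernel/= -EFinM.
  case: ifPn => [/andP[s0 _]|_]; last by rewrite mulr0.
  rewrite tpow_sub_inv// powRM ?ltW// (tpow_gt0E _ s0); congr (_%:E).
  have -> : (s `^ (alpha - 1) = s `^ (alpha + a - 2) * s `^ (1 - a))%R.
    by rewrite -powRD ?(gt_eqF s0) ?implybT//; congr (_ `^ _)%R; ring.
  ring.
rewrite lebesgue_integralZl//; last 3 first.
- exact: measurable_cweight_integrand.
- exact: cweight_integrand_ge0.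
- by rewrite lee_fin powR_ge0.
rewrite muleAC -EFinM -powRD ?(gt_eqF t0) ?implybT//.
Qed.

Lemma cweight1 y t : (0 < t)%R -> (0 < y)%R ->
  cweight 1 y t = (Num.min y t `^ alpha / alpha)%:E.
Proof.
move=> t0 y0; have m0 : (0 < Num.min y t)%R by rewrite lt_min y0.
rewrite -integral_powR_itv//; apply: eq_integral => s _; congr (_%:E).
rewrite tpow1 lt_min subr_gt0; case: (ltP 0%R s) => s0 //=.
by rewrite tpow_gt0E//; case: (s < y)%R; case: (s < t)%R; rewrite ?(mul1r, mul0r).
Qed.

(** Extending the integral from [(0, y)] to [(0, t)] gives a complete Beta
    integral, in which the powers of [t] cancel. *)
Lemma cint_le_cst a y t : (0 < a)%R -> (0 < t)%R ->
  cint a y (t^-1)%R * (t `^ (- alpha))%:E <= ebeta a alpha.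
Proof.
move=> a0 t0; rewrite cintV//.
have -> : ebeta a alpha = (t `^ (1 - a - alpha))%:E *
    (ebeta a alpha * (tpow (a + alpha) t)%:E).
  rewrite tpow_gt0E// muleCA -EFinM -powRD ?(gt_eqF t0) ?implybT//.
  have -> : (1 - a - alpha + (a + alpha - 1) = 0)%R by ring.
  by rewrite powRr0 mule1.
rewrite -integral_tpow_conv; apply: lee_wpmul2l; first by rewrite lee_fin powR_ge0.
apply: lebesgue_le_integral.
- exact: measurable_cweight_integrand.
- exact: measurable_tpow_conv0.
- exact: cweight_integrand_ge0.
- by move=> s; rewrite lee_fin; case: ifP => // _; rewrite mulr_ge0 ?tpow_ge0.
Qed.

(** For [s < y <= t / 2] the factor [t - s] lies between [t / 2] and [t], so
    [(t - s) `^ (a - 1)] is comparable to [t `^ (a - 1)]; the constant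
    [1 + 2^-1 `^ (a - 1)] covers both signs of [a - 1]. *)
Lemma cint_le_far a y t : (0 < y)%R -> (2 * y <= t)%R ->
  cint a y (t^-1)%R * (t `^ (- alpha))%:E <=
  ((1 + 2^-1 `^ (a - 1)) * (y `^ alpha / alpha) * t `^ (- alpha))%:E.
Proof.
move=> y0 yt; have t0 : (0 < t)%R by lra.
rewrite cintV//; set c := (1 + 2^-1 `^ _)%R.
have c0 : (0 <= c)%R by rewrite addr_ge0 ?powR_ge0.
have -> : (c * (y `^ alpha / alpha) * t `^ (- alpha))%:E =
    (t `^ (1 - a - alpha))%:E * ((c * t `^ (a - 1))%:E * (y `^ alpha / alpha)%:E).
  rewrite -!EFinM; congr (_%:E).
  have -> : (t `^ (- alpha) = t `^ (1 - a - alpha) * t `^ (a - 1))%R.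
    by rewrite -powRD ?(gt_eqF t0) ?implybT//; congr (_ `^ _)%R; ring.
  ring.
rewrite -integral_powR_itv//.
have mp : measurable_fun setT
    (fun s : R => (if (0 < s < y)%R then s `^ (alpha - 1) else 0%R)%:E).
  apply/measurable_EFinP; apply: measurable_fun_ifT => //.
  exact: measurable_itvoo_bool.
have p0 s : 0 <= (if (0 < s < y)%R then s `^ (alpha - 1) else 0%R)%:E.
  by rewrite lee_fin; case: ifP => // _; exact: powR_ge0.
have k0 : 0 <= (c * t `^ (a - 1))%:E by rewrite lee_fin mulr_ge0 ?powR_ge0.
rewrite -(lebesgue_integralZl mp p0 k0).
apply: lee_wpmul2l; first by rewrite lee_fin powR_ge0.
apply: lebesgue_le_integral.
- exact: measurable_cweight_integrand.
- exact: emeasurable_funM.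
- exact: cweight_integrand_ge0.
- move=> s; rewrite -EFinM lee_fin; case: ifPn => [/andP[s0 sy]|_]; last by rewrite mulr0.
  have ts0 : (0 < t - s)%R by lra.
  rewrite !tpow_gt0E//; apply: ler_wpM2r; first exact: powR_ge0.
  have [a1|a1] := leP 1%R a.
    apply: (@le_trans _ _ (1 * t `^ (a - 1))%R).
      by rewrite mul1r ge0_ler_powR ?nnegrE//; lra.
    by rewrite ler_wpM2r ?powR_ge0// lerDl powR_ge0.
  apply: (@le_trans _ _ (2^-1 `^ (a - 1) * t `^ (a - 1))%R); last first.
    by rewrite ler_wpM2r ?powR_ge0// lerDr.
  rewrite -powRM ?(ltW t0)// -(opprB 1%R a) !powRN lef_pV2 ?posrE ?powR_gt0//; last by lra.
  by rewrite ge0_ler_powR ?nnegrE//; lra.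
Qed.

(** The two regimes together: the left-hand side is at most a constant times the
    minimum of [1] and [(y / t) `^ alpha].  For [t < 2 * y] the second bound follows from
    the first one at the cost of a factor [2 `^ alpha]. *)
Lemma cint_bound a : (0 < a)%R -> exists2 C : R, (0 < C)%R &
  forall y t, (0 < y)%R -> (0 < t)%R ->
    cint a y (t^-1)%R * (t `^ (- alpha))%:E <= C%:E /\
    cint a y (t^-1)%R * (t `^ (- alpha))%:E <= (C * y `^ alpha * t `^ (- alpha))%:E.
Proof.
move=> a0; set b := (Gamma a * Gamma alpha / Gamma (a + alpha))%R.
have b0 : (0 < b)%R by rewrite divr_gt0 ?mulr_gt0 ?Gamma_gt0// addr_gt0.
pose c := ((1 + 2^-1 `^ (a - 1)) / alpha)%R.
have c0 : (0 <= c)%R by rewrite divr_ge0 ?addr_ge0 ?powR_ge0// ltW.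
have two : (0 < 2 `^ alpha :> R)%R by rewrite powR_gt0.
have b2 : (0 < b * 2 `^ alpha)%R by exact: mulr_gt0.
exists (b + b * 2 `^ alpha + c)%R; first by apply: ltr_wpDr => //; exact: addr_gt0.
move=> y t y0 t0; have le_b := @cint_le_cst a y t a0 t0.
rewrite ebetaE// -/b in le_b.
have ya : (0 < y `^ alpha)%R by rewrite powR_gt0.
have ta : (0 < t `^ (- alpha))%R by rewrite powR_gt0.
split.
  apply: le_trans le_b _; rewrite lee_fin -addrA lerDl addr_ge0//.
  exact: ltW.
have [yt|ty] := leP (2 * y)%R t.
  apply: le_trans (cint_le_far a y0 yt) _; rewrite lee_fin.
  apply: ler_wpM2r; first exact: ltW.
  have -> : ((1 + 2^-1 `^ (a - 1)) * (y `^ alpha / alpha) = c * y `^ alpha)%R.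
    by rewrite /c; ring.
  apply: ler_wpM2r; first exact: ltW.
  by rewrite lerDr addr_ge0 ?(ltW b0) ?(ltW b2).
apply: le_trans le_b _; rewrite lee_fin.
apply: (@le_trans _ _ (b * 2 `^ alpha * y `^ alpha * t `^ (- alpha))%R); last first.
  rewrite ler_wpM2r ?(ltW ta)// ler_wpM2r ?(ltW ya)// addrAC lerDr.
  by rewrite addr_ge0// ltW.
have -> : (b * 2 `^ alpha * y `^ alpha * t `^ (- alpha) =
    b * ((2 * y) `^ alpha / t `^ alpha))%R.
  by rewrite powRM ?(ltW y0)// powRN; ring.
rewrite -{1}(mulr1 b) ler_wpM2l ?(ltW b0)// ler_pdivlMr ?powR_gt0// mul1r.
apply: ge0_ler_powR; rewrite ?nnegrE ?mulr_ge0 ?(ltW t0) ?(ltW y0) ?(ltW ty)//.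
exact: ltW.
Qed.

Variable mu : {measure set (\bar R) -> \bar R}.
Variable rho : {measure set R -> \bar R}.
Hypothesis rhoE : represents_inversion alpha mu rho.
Hypothesis muM : classM alpha mu.

Let rho_lty := inverted_lty alpha_gt0 rhoE muM.

(** Tonelli on the left-hand side; the first term on the right is the contribution
    of the atom of [rho] at [0], which is the atom of [mu] at infinity. *)
Lemma integral_power_RL a y : (0 < y)%R ->
  \int[leb]_s (if (0 < s < y)%R then
     (s `^ (alpha + a - 2))%:E * RL rho a (s^-1)%R else 0) =
  (y `^ alpha / alpha)%:E * mu [set +oo] +
  \int[mu]_(t in [set t | 0 < t < +oo])
    (cint a y ((fine t)^-1)%R * (fine t `^ (- alpha))%:E).
Proof.
move=> y0.
transitivity (\int[leb]_s \int[rho]_w (EFin \o ckernel a y) (w, s)).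
  apply: eq_integral => s _; rewrite /ckernel/=.
  case: ifPn => sy; last by rewrite integral0.
  rewrite -ge0_integralZl//.
  - apply/measurable_EFinP; apply: measurable_tpow_comp; exact: measurable_funB.
  - by move=> w _; rewrite lee_fin tpow_ge0.
  - by rewrite lee_fin powR_ge0.
rewrite lebesgue_tonelli//; last 3 first.
- exact: sigma_finite_locally_finite.
- exact: measurable_ckernel.
- by move=> z; rewrite lee_fin ckernel_ge0.
rewrite -(cint0 a y0); apply: rhoE; first exact: measurable_cint.
exact: cint_ge0.
Qed.

End CumulatedKernel.

#[local] Opaque RL RLn.

(** * The Kober-Erdelyi integral as a measure *)

Section KoberErdelyiMeasure.
Context {R : realType}.
Local Notation leb := (@lebesgue_measure R).
Variables alpha eta : R.
Hypotheses (alpha_gt0 : 0 < alpha) (eta_gt0 : 0 < eta).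
Variable mu : {measure set (\bar R) -> \bar R}.
Variable rho : {measure set R -> \bar R}.
Hypothesis rhoE : represents_inversion alpha mu rho.
Hypothesis muM : classM alpha mu.
Local Open Scope ereal_scope.

Let rho_lty := inverted_lty alpha_gt0 rhoE muM.

Definition kdensity (y : R) : \bar R := if (0 < y)%R then
  ((Gamma eta)^-1 * y `^ (alpha + eta - 2))%:E * RL rho eta (y^-1)%R else 0.

Let Gamma_inv_ge0 : (0 <= (Gamma eta)^-1)%R.
Proof. by rewrite invr_ge0 ltW// Gamma_gt0. Qed.

Lemma kdensity_ge0 y : 0 <= kdensity y.
Proof.
rewrite /kdensity; case: ifP => _; last exact: lexx.
by rewrite mule_ge0 ?RL_ge0// lee_fin mulr_ge0 ?powR_ge0.
Qed.

Lemma measurable_RLV a : measurable_fun setT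
  (fun y : R => if (0 < y)%R then RL rho a (y^-1)%R else 0).
Proof.
apply: (eq_measurable_fun (fun y : R =>
    if (0 < y)%R then RL rho a (y `^ (-1))%R else 0)).
  by move=> y _; have [y0|_] := ltP 0%R y; [rewrite powR_inv1// ltW|].
apply: measurable_fun_ifT => //.
  exact: (@measurable_fun_ltr _ _ R setT (cst 0%R) id).
apply: (measurableT_comp (measurable_RL rho_lty a)).
exact: (@measurable_powR R (-1)).
Qed.

Lemma measurable_kdensity : measurable_fun setT kdensity.
Proof.
apply: (eq_measurable_fun (fun y : R => ((Gamma eta)^-1 * y `^ (alpha + eta - 2))%:E *
    (if (0 < y)%R then RL rho eta (y^-1)%R else 0))).
  by move=> y _; rewrite /kdensity; case: ifP => //; rewrite mule0.
apply: emeasurable_funM; last exact: measurable_RLV.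
apply/measurable_EFinP; apply: measurable_funM => //; exact: measurable_powR.
Qed.

Lemma measurable_EFin_preimage (B : set (\bar R)) :
  measurable B -> measurable (EFin @^-1` B : set R).
Proof.
move=> mB; rewrite -[X in measurable X]setTI.
exact: (@EFin_measurable R setT measurableT B mB).
Qed.

Lemma kober_erdelyi_density B : measurable B ->
  kober_erdelyi alpha eta mu B =
  mu (B `&` [set 0]) + \int[leb]_(y in EFin @^-1` B) kdensity y.
Proof.
move=> mB; rewrite /kober_erdelyi; congr (_ + _).
set D := (X in \int[_]_(y in X) _).
have DE : D = (EFin @^-1` B) `&` [set y | (0 < y)%R].
  by apply/seteqP; split=> y /= [].
have mD : measurable D.
  rewrite DE; apply: measurableI; first exact: measurable_EFin_preimage.
  apply: measurable_bool_set.
  exact: (@measurable_fun_ltr _ _ R setT (cst 0%R) id).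
transitivity ((Gamma eta)^-1%:E * \int[leb]_(y in D)
    ((y `^ (alpha + eta - 2))%:E * (if (0 < y)%R then RL rho eta (y^-1)%R else 0))).
  congr (_ * _); apply: eq_integral => y; rewrite inE => -[y0 _].
  rewrite (kober_erdelyi_inner rhoE _ y0) y0 muleA -EFinM; congr (_%:E * _).
  by rewrite -powRD ?(gt_eqF y0) ?implybT//; congr (_ `^ _)%R; ring.
rewrite -ge0_integralZl//; last 2 first.
- apply: measurable_funTS; apply: emeasurable_funM; last exact: measurable_RLV.
  by apply/measurable_EFinP; exact: measurable_powR.
- move=> y _; rewrite mule_ge0 ?lee_fin ?powR_ge0//.
  by case: ifP => _; [exact: RL_ge0|exact: lexx].
rewrite [LHS]integral_mkcond [RHS]integral_mkcond; apply: eq_integral => y _.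
rewrite !patchE /kdensity DE in_setI.
case: (y \in EFin @^-1` B) => //=; rewrite [y \in _]inE/=.
rewrite asboolb; case: ifP => // y0.
by rewrite y0 muleA EFinM.
Qed.

Lemma kober_erdelyi_measure_exists :
  exists tau : {measure set (\bar R) -> \bar R},
    forall B, measurable B -> tau B = kober_erdelyi alpha eta mu B.
Proof.
pose phi (y : measurableTypeR R) : \bar R := y%:E.
have mphi : measurable_fun setT phi by exact: (@EFin_measurable R setT).
have [nu nuE] := @image_density_exists _ _ _ _ R leb phi kdensity mphi
  measurable_kdensity kdensity_ge0.
have m0 : measurable ([set 0] : set (\bar R)) by exact: emeasurable_set1.
exists (measure_add (mrestr mu m0) nu) => B mB.
by rewrite kober_erdelyi_density// [LHS]measure_addE nuE.
Qed.

Variable tau : {measure set (\bar R) -> \bar R}.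
Hypothesis tauE :
  forall B, measurable B -> tau B = kober_erdelyi alpha eta mu B.

Lemma integral_tau (x : R) (f : \bar R -> \bar R) : (0 <= x)%R ->
  measurable_fun setT f -> (forall t, 0 <= f t) ->
  \int[tau]_(s in [set s | x%:E < s < +oo]) f s =
  \int[leb]_y (if (x < y)%R then f y%:E * kdensity y else 0).
Proof.
move=> x0 mf f0.
pose phi (y : measurableTypeR R) : \bar R := y%:E.
have mphi : measurable_fun setT phi by exact: (@EFin_measurable R setT).
have [nu nuE] := @image_density_exists _ _ _ _ R leb phi kdensity mphi
  measurable_kdensity kdensity_ge0.
transitivity (\int[nu]_(s in [set s | x%:E < s < +oo]) f s).
  apply: eq_measure_integral => A mA AD.
  rewrite tauE// kober_erdelyi_density// nuE (_ : A `&` _ = set0) ?measure0 ?add0e//.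
  by apply/seteqP; split=> // t [/AD /= /andP[+ _] t0]; rewrite t0 lte_fin ltNge x0.
rewrite (@integral_image_density _ _ _ _ R leb phi kdensity mphi measurable_kdensity
  kdensity_ge0 nu (fun A _ => nuE A))//.
- by apply: integral_boolE => y; rewrite /phi /= lte_fin ltry andbT.
- exact: measurable_eitvoo.
- exact: measurable_funTS.
Qed.

Lemma tau_set0 : tau [set 0] = mu [set 0].
Proof.
rewrite tauE// kober_erdelyi_density// setIid integral0_eq ?adde0// => y /= [->].
by rewrite /kdensity ltxx.
Qed.

Lemma cdf_left_tau (y : R) : (0 < y)%R -> cdf_left tau y = mu [set 0] +
  (Gamma eta)^-1%:E * ((y `^ alpha / alpha)%:E * mu [set +oo] +
    \int[mu]_(t in [set t | 0 < t < +oo])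
      (cint alpha eta y ((fine t)^-1)%R * (fine t `^ (- alpha))%:E)).
Proof.
move=> y0; rewrite /cdf_left tauE; last exact: measurable_eitvco.
rewrite kober_erdelyi_density; last exact: measurable_eitvco.
congr (mu _ + _).
  by apply/seteqP; split=> t /=; [case|move=> ->; rewrite lexx lte_fin].
rewrite -(integral_power_RL alpha_gt0 rhoE muM _ y0).
have mP : measurable_fun setT (fun s : R => if (0 < s < y)%R then
    (s `^ (alpha + eta - 2))%:E * RL rho eta (s^-1)%R else 0).
  apply: (eq_measurable_fun (fun s : R => if (0 < s < y)%R then
    (s `^ (alpha + eta - 2))%:E * (if (0 < s)%R then RL rho eta (s^-1)%R else 0) else 0)).
    by move=> s _; case: ifP => // /andP[-> _].
  apply: measurable_fun_ifT => //; first exact: measurable_itvoo_bool.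
  apply: emeasurable_funM; last exact: measurable_RLV.
  by apply/measurable_EFinP; exact: measurable_powR.
rewrite -(lebesgue_integralZl mP)//; last first.
  move=> s; case: ifP => _; last exact: lexx.
  by rewrite mule_ge0 ?RL_ge0// lee_fin powR_ge0.
rewrite (@integral_boolE _ _ _ leb _ (fun s => (0 <= s < y)%R)); last first.
  by move=> s; rewrite /= lee_fin lte_fin.
apply: eq_integral => s _; rewrite /kdensity.
have [s0|s0|<-] := ltgtP 0%R s; rewrite ?ltxx ?mule0//; last by case: ifP.
by rewrite andTb; case: ifP => _; rewrite ?mule0// EFinM muleA.
Qed.

End KoberErdelyiMeasure.

(** * Iterated derivatives of the base function *)

Section Inversion.
Context {R : realType}.
Local Notation leb := (@lebesgue_measure R).
Variables alpha eta : R.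
Hypotheses (alpha_gt0 : 0 < alpha) (eta_gt0 : 0 < eta).
Variable mu : {measure set (\bar R) -> \bar R}.
Variable rho : {measure set R -> \bar R}.
Hypothesis rhoE : represents_inversion alpha mu rho.
Hypothesis muM : classM alpha mu.
Variable tau : {measure set (\bar R) -> \bar R}.
Hypothesis tauE :
  forall B, measurable B -> tau B = kober_erdelyi alpha eta mu B.

Let rho_lty := inverted_lty alpha_gt0 rhoE muM.
Let rho_lt0 := inverted_lt0 rhoE.

Local Notation n := (Num.truncn eta).
Local Notation theta := (eta - n%:R).

Let theta_lt1 : 0 < 1 - theta.
Proof. by have := truncnS_gt eta; rewrite -natr1; lra. Qed.

Lemma inv_kernel_ge0 x s : 0 <= inv_kernel alpha eta x s.
Proof. by rewrite invr_ge0 mulr_ge0 ?powR_ge0. Qed.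

Lemma measurable_inv_kernel x : measurable_fun setT (EFin \o inv_kernel alpha eta x).
Proof.
apply/measurable_EFinP; rewrite /inv_kernel.
have -> : (fun s : \bar R => (fine s `^ (alpha + n%:R) * (fine s - x) `^ theta)^-1) =
    (fun s : \bar R => fine s `^ (- (alpha + n%:R)) * (fine s - x) `^ (- theta)).
  by apply/funext => s; rewrite invfM !powRN.
apply: measurable_funM; first exact: measurable_powR_fine.
apply: (measurableT_comp (@measurable_powR R _)).
by apply: measurable_funB => //; exact: measurable_fine_setT.
Qed.

Local Open Scope ereal_scope.

(** In the variable [S = 1 / s] the kernel becomes [tpow (1 - theta) (1 / x - S)],
    while [tau] has a density in terms of [RL rho eta S]; the semigroup law applies
    with [1 - theta + eta = n + 1].  The remaining constants cancel since
    [Gamma (n + 1) = n!]. *)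
Lemma integral_inv_kernel (x : R) : (0 < x)%R ->
  \int[tau]_(s in [set s | x%:E < s < +oo]) (inv_kernel alpha eta x s)%:E =
  (x `^ (- theta) * (Gamma (1 - theta) * RLn rho n (x^-1)))%:E.
Proof.
move=> x0; have G0 := Gamma_gt0 eta_gt0.
rewrite (integral_tau alpha_gt0 eta_gt0 rhoE muM tauE (ltW x0)); last 2 first.
- exact: measurable_inv_kernel.
- by move=> t; rewrite lee_fin inv_kernel_ge0.
pose g (S : R) := (tpow (1 - theta) (x^-1 - S))%:E * RL rho eta S.
have mg : measurable_fun setT g.
  apply: emeasurable_funM; last exact: measurable_RL.
  by apply/measurable_EFinP; apply: measurable_tpow_comp; exact: measurable_funB.
have g0 S : 0 <= g S by rewrite mule_ge0 ?RL_ge0// lee_fin tpow_ge0.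
have mgV : measurable_fun setT
    (fun y : R => if (0 < y)%R then g (y^-1)%R * (y ^- 2)%:E else 0).
  apply: (eq_measurable_fun (fun y : R =>
      if (0 < y)%R then g (y `^ (-1))%R * (y `^ (- 2))%:E else 0)).
    move=> y _; have [y0|_] := ltP 0%R y; last by [].
    by rewrite powR_inv1 ?(ltW y0)// -powR_invn ?(ltW y0).
  apply: measurable_fun_ifT => //.
    exact: (@measurable_fun_ltr _ _ R setT (cst 0%R) id).
  apply: emeasurable_funM.
    exact: (measurableT_comp mg (@measurable_powR R (-1))).
  by apply/measurable_EFinP; exact: measurable_powR.
transitivity (\int[leb]_y ((x `^ (- theta) / Gamma eta)%:E *
    (if (0 < y)%R then g (y^-1)%R * (y ^- 2)%:E else 0))).
  apply: eq_integral => y _; rewrite /g /kdensity.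
  have [y0|y0] := ltP 0%R y; last first.
    rewrite ifF ?mule0//; apply/negbTE.
    by rewrite -leNgt (le_trans y0)// ltW.
  have [xy|yx] := ltP x y; last first.
    by rewrite tpow_sub_inv// tpow_le0 ?subr_le0// mulr0 !mul0e mule0.
  have E : (inv_kernel alpha eta x y%:E * ((Gamma eta)^-1 * y `^ (alpha + eta - 2)) =
      x `^ (- theta) / Gamma eta * (tpow (1 - theta) (x^-1 - y^-1) * y ^- 2))%R.
    rewrite tpow_sub_inv// tpow_gt0E ?subr_gt0// powRM ?(ltW x0) ?(ltW y0)//.
    rewrite /inv_kernel/= invfM -!powRN.
    have -> : (1 - (1 - theta) = theta)%R by ring.
    have -> : (1 - theta - 1 = - theta)%R by ring.
    have Ey : (y `^ (- (alpha + n%:R)) * y `^ (alpha + eta - 2) = y `^ theta * y ^- 2)%R.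
      rewrite -powR_invn ?(ltW y0)// -!powRD ?(gt_eqF y0) ?implybT//.
      by congr (_ `^ _)%R; ring.
    have Ex : (x `^ (- theta) * x `^ theta = 1)%R.
      by rewrite powRN mulVf// gt_eqF ?powR_gt0.
    transitivity ((y `^ (- (alpha + n%:R)) * y `^ (alpha + eta - 2)) *
      (y - x) `^ (- theta) / Gamma eta)%R; first by ring.
    rewrite Ey; transitivity (x `^ (- theta) * x `^ theta * (y `^ theta * y ^- 2 *
      (y - x) `^ (- theta) / Gamma eta))%R; first by rewrite Ex mul1r.
    by ring.
  by rewrite muleA -EFinM E muleAC -EFinM muleA -EFinM.
rewrite lebesgue_integralZl//; last 2 first.
- move=> y; case: ifP => _; last exact: lexx.
  by rewrite mule_ge0// lee_fin invr_ge0 sqr_ge0.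
- by rewrite lee_fin; exact: divr_ge0 (powR_ge0 _ _) (ltW G0).
rewrite -integral_oyE -integral_inversion// integral_oyE.
transitivity ((x `^ (- theta) / Gamma eta)%:E * \int[leb]_S g S).
  congr (_ * _); apply: eq_integral => S _.
  have [//|S0] := ltP 0%R S.
  by rewrite /g (RL_le0 rho_lt0 _ S0) mule0.
rewrite RL_semigroup// ebetaE//.
have -> : (1 - theta + eta = n%:R + 1)%R by ring.
have := EFin_RLn rho_lt0 rho_lty n (x^-1)%R; rewrite /eRLn.
move: (RLn rho n _) => r E.
rewrite mulrA [RHS]EFinM E Gamma_natS !muleA -!EFinM; congr (_%:E * _).
have f0 : (n`!%:R != 0 :> R)%R by rewrite pnatr_eq0 -lt0n fact_gt0.
have g0' : (Gamma eta != 0)%R by rewrite gt_eqF.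
by field; rewrite f0 g0'.
Qed.

Local Close Scope ereal_scope.

Lemma inv_baseE (x : R) : 0 < x ->
  inv_base alpha eta tau x = Gamma (1 - theta) * RLn rho n x^-1.
Proof.
move=> x0; rewrite /inv_base /Rintegral integral_inv_kernel//= mulrA.
rewrite -powRD ?(gt_eqF x0) ?implybT//.
by rewrite subrr powRr0 mul1r.
Qed.

(** The two claims are proved together: for [k > 0] the value of an iterate at
    [x] is given by the derivative of the previous one.  An atom at [x] matters
    only for the last derivative, the one that produces [RLn rho 0]. *)
Lemma inv_iter_spec k (x : R) : 0 < x -> (k <= n)%N ->
  (k < n)%N \/ k = 0%N \/ mu [set x%:E] = 0%E ->
  Defs.inv_iter alpha eta tau k x = Gamma (1 - theta) * RLn rho (n - k) x^-1 /\
  ((k < n)%N -> (k.+1 < n)%N \/ mu [set x%:E] = 0%E ->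
    is_derive x 1 (Defs.inv_iter alpha eta tau k)
      (Gamma (1 - theta) * (- x ^- 2 * RLn rho (n - k.+1) x^-1))).
Proof.
have step j : (forall z, 0 < z ->
      Defs.inv_iter alpha eta tau j z = Gamma (1 - theta) * RLn rho (n - j) z^-1) ->
    forall z, 0 < z -> (j < n)%N -> (j.+1 < n)%N \/ mu [set z%:E] = 0%E ->
    is_derive z 1 (Defs.inv_iter alpha eta tau j)
      (Gamma (1 - theta) * (- z ^- 2 * RLn rho (n - j.+1) z^-1)).
  move=> IH z z0 jn jz.
  have D : is_derive z 1 (fun t => RLn rho (n - j.+1).+1 t^-1)
      (- z ^- 2 * RLn rho (n - j.+1) z^-1).
    apply: (RLnS_inv_is_derive rho_lt0 rho_lty z0).
    case: jz => [jn'|muz]; first by left; rewrite subn_gt0.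
    by right; exact: (inverted_set1 rhoE z0 muz).
  have DG := is_deriveZ (Gamma (1 - theta)) D.
  (* The closed form of the iterate is known on the whole of [(0, oo)], thus
     near [z]. *)
  apply: near_eq_is_derive DG; near=> t.
  by rewrite /= IH ?subnSK//; near: t; exact: lt_nbhsr.
elim: k x => [|k IH] x x0 kn kx.
  split; first by rewrite subn0; exact: inv_baseE.
  by move=> n0 nx; apply: step => // z z0; rewrite subn0; exact: inv_baseE.
have IHk z : 0 < z ->
    Defs.inv_iter alpha eta tau k z = Gamma (1 - theta) * RLn rho (n - k) z^-1.
  by move=> z0; apply: (IH z z0 (ltnW kn) _).1; left.
have valE z : 0 < z -> (k.+1 < n)%N \/ mu [set z%:E] = 0%E ->
    Defs.inv_iter alpha eta tau k.+1 z = Gamma (1 - theta) * RLn rho (n - k.+1) z^-1.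
  move=> z0 kz; have [_ Dz] := step k IHk z z0 kn kz.
  rewrite /Defs.inv_iter iterS /opD -/(Defs.inv_iter alpha eta tau k) derive1E Dz.
  by field; rewrite gt_eqF.
split; first by apply: valE => //; case: kx => [|[//|]]; [left|right].
by move=> kn' kz; apply: step => // z z0; apply: valE => //; left.
Unshelve. all: by end_near. Qed.

End Inversion.

(** * The inversion formula *)

(** The last iterate of the inversion formula has a closed form only away from the
    atoms of [mu]; the lemma makes it measurable nevertheless. *)
Lemma countable_modification_measurable d (T : measurableType d) (R : realType)
    (D N : set T) (f g : T -> R) :
  (forall x : T, measurable [set x]) -> countable N ->
  (forall x, D x -> ~ N x -> f x = g x) ->
  measurable_fun D g -> measurable_fun D f.
Proof.
move=> m1 cN fg mg mD Y mY.
have mN (A : set T) : measurable (A `&` N).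
  apply: countable_measurable => //.
  by apply: sub_countable cN; apply: subset_card_le => x [].
have -> : D `&` f @^-1` Y =
    ((D `&` g @^-1` Y) `\` N) `|` ((D `&` f @^-1` Y) `&` N).
  apply/seteqP; split=> x /=.
    move=> [Dx fx]; have [Nx|Nx] := pselect (N x); [by right|left].
    by rewrite -fg.
  by move=> [[[Dx gx] Nx]|[[]]//]; split=> //; rewrite fg.
apply: measurableU; last exact: mN.
apply: measurableD; first exact: mg.
by rewrite -[X in measurable X]setTI; exact: mN.
Qed.

Section ClassM.
Context {R : realType}.
Variable alpha : R.
Hypothesis alpha_gt0 : 0 < alpha.
Variable mu : {measure set (\bar R) -> \bar R}.
Hypothesis muM : classM alpha mu.
Local Open Scope ereal_scope.

(** On a bounded set the weight [(1 + t) `^ (- alpha)] is bounded below. *)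
Lemma classM_lty (x : R) : (0 < x)%R -> mu [set t | 0 <= t < x%:E] < +oo.
Proof.
move=> x0; have [_ muf _] := muM.
have mG : measurable_fun setT (fun t : \bar R =>
    ((1 + x) `^ alpha)%:E * ((1 + fine t) `^ (- alpha))%:E).
  by apply: emeasurable_funM => //; exact: measurable_weight.
have G0 (t : \bar R) : 0 <= ((1 + x) `^ alpha)%:E * ((1 + fine t) `^ (- alpha))%:E.
  by rewrite mule_ge0 ?lee_fin ?powR_ge0.
apply: (@le_lt_trans _ _ (\int[mu]_(t in [set t | 0 <= t < +oo])
    (((1 + x) `^ alpha)%:E * ((1 + fine t) `^ (- alpha))%:E))); last first.
  rewrite ge0_integralZl//.
  - by rewrite lte_mul_pinfty// lee_fin powR_ge0.
  - exact: measurable_eitvco.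
  - by apply: measurable_funTS; exact: measurable_weight.
  - by move=> t _; rewrite lee_fin powR_ge0.
  - by rewrite lee_fin powR_ge0.
apply: (@le_trans _ _ (\int[mu]_(t in [set t | 0 <= t < x%:E])
    (((1 + x) `^ alpha)%:E * ((1 + fine t) `^ (- alpha))%:E))); last first.
  apply: ge0_subset_integral.
  - exact: measurable_eitvco.
  - exact: measurable_eitvco.
  - exact: measurable_funTS.
  - by move=> t _; exact: G0.
  - by move=> t /= /andP[-> tx]; rewrite (lt_trans tx) ?ltry.
rewrite -[X in X <= _]mul1e -integral_cst; last exact: measurable_eitvco.
apply: ge0_le_integral => //.
- exact: measurable_eitvco.
- exact: measurable_funTS.
- move=> t /= /andP[t0 tx]; rewrite -EFinM lee_fin powRN.
  have tf : t \is a fin_num by rewrite ge0_fin_numE// (lt_trans tx) ?ltry.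
  have {}t0 : (0 <= fine t)%R by rewrite fine_ge0.
  have {}tx : (fine t < x)%R by rewrite -lte_fin fineK.
  have t1 : (0 < 1 + fine t)%R by rewrite ltr_wpDr.
  rewrite ler_pdivlMr ?powR_gt0// mul1r.
  apply: ge0_ler_powR; rewrite ?nnegrE ?addr_ge0 ?(ltW x0) ?(ltW alpha_gt0)//.
  by rewrite lerD2l ltW.
Qed.

Definition atoms : set R := [set x | (0 < x)%R /\ mu [set x%:E] != 0].

Lemma countable_classM_atoms : countable atoms.
Proof.
pose F k : set (\bar R) := [set t | 0 <= t < k.+1%:R%:E].
apply: (@sub_countable _ _ _ (\bigcup_k (fine @` [set t | F k t /\ mu [set t] != 0]))).
  apply: subset_card_le => x [x0 xN]; exists (Num.truncn x) => //=.
  exists x%:E => //; split=> //; rewrite /F/= lee_fin (ltW x0) lte_fin.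
  exact: truncnS_gt.
apply: bigcup_countable => // k _.
apply: (@sub_countable _ _ _ [set t | F k t /\ mu [set t] != 0]).
  exact: card_image_le.
apply: countable_atoms.
- by move=> t; exact: emeasurable_set1.
- exact: measurable_eitvco.
- by apply: classM_lty; rewrite ltr0n.
Qed.

Variable rho : {measure set R -> \bar R}.
Hypothesis rhoE : represents_inversion alpha mu rho.
Local Notation leb := (@lebesgue_measure R).

(** By [integral_power_RL] with [a = 1], each [t] enters the left-hand side with
    the weight [Num.min y t `^ alpha * t `^ (- alpha)].  It is [1] for [t <= y],
    which gives the mass of [(0, y]]; for [t > y] it is [y `^ alpha] times the
    weight of [1 / t] in [rho], and [RL rho 1 (1 / y)] is the total of these
    weights together with the atom at infinity. *)
Lemma integral_RL1_mass (y : R) : (0 < y)%R ->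
  alpha%:E * \int[leb]_s (if (0 < s < y)%R then
    (s `^ (alpha - 1))%:E * RL rho 1 (s^-1)%R else 0) =
  mu [set t | 0 < t <= y%:E] + (y `^ alpha)%:E * RL rho 1 (y^-1)%R.
Proof.
move=> y0.
have -> : (alpha - 1 = alpha + 1 - 2)%R by ring.
rewrite (integral_power_RL alpha_gt0 rhoE muM 1 y0) (inverted_RLE rhoE).
have mu_ge0 A : 0 <= mu A by exact: measure_ge0.
have ya0 : 0 <= (y `^ alpha)%:E by rewrite lee_fin powR_ge0.
have mc : measurable_fun [set t : \bar R | 0 < t < +oo] (fun t =>
    cint alpha 1 y (fine t)^-1%R * (fine t `^ (- alpha))%:E).
  by apply: measurable_inverted; exact: measurable_cint.
have c0 (t : \bar R) : 0 <= cint alpha 1 y (fine t)^-1%R * (fine t `^ (- alpha))%:E.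
  by rewrite mule_ge0 ?cint_ge0// lee_fin powR_ge0.
have mt : measurable_fun [set t : \bar R | 0 < t < +oo] (fun t =>
    (tpow 1 (y^-1 - (fine t)^-1))%:E * (fine t `^ (- alpha))%:E).
  apply: (@measurable_inverted _ _ (fun w => (tpow 1 (y^-1 - w))%:E)).
  by apply/measurable_EFinP; apply: measurable_tpow_comp; exact: measurable_funB.
have t0 (t : \bar R) : 0 <= (tpow 1 (y^-1 - (fine t)^-1))%:E * (fine t `^ (- alpha))%:E.
  by rewrite mule_ge0// lee_fin ?tpow_ge0 ?powR_ge0.
have mD : measurable [set t : \bar R | 0 < t < +oo] by exact: measurable_eitvoo.
have I0 : 0 <= \int[mu]_(t in [set t | 0 < t < +oo])
    (cint alpha 1 y (fine t)^-1%R * (fine t `^ (- alpha))%:E).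
  by apply: integral_ge0.
rewrite ge0_muleDr//; last by rewrite mule_ge0// lee_fin divr_ge0 ?powR_ge0// ltW.
have T0 : 0 <= (tpow 1 y^-1)%:E * mu [set +oo].
  by rewrite mule_ge0// lee_fin tpow_ge0.
have J0 : 0 <= \int[mu]_(t in [set t | 0 < t < +oo])
    ((tpow 1 (y^-1 - (fine t)^-1))%:E * (fine t `^ (- alpha))%:E).
  by apply: integral_ge0.
rewrite (ge0_muleDr _ T0 J0) addeCA; congr (_ + _).
  rewrite !muleA -!EFinM tpow1 invr_gt0 y0 mulr1; congr (_%:E * _).
  by rewrite mulrC divfK// gt_eqF.
rewrite -ge0_integralZl//; last by rewrite lee_fin ltW.
rewrite -ge0_integralZl//.
have -> : mu [set t | 0 < t <= y%:E] =
    \int[mu]_(t in [set t | 0 < t < +oo]) (if t <= y%:E then 1 else 0).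
  rewrite -[LHS]mul1e -integral_cst.
    rewrite (@integral_boolE _ _ _ mu _ (fun t => 0 < t <= y%:E))//.
    rewrite (@integral_boolE _ _ _ mu [set t | 0 < t < +oo] (fun t => 0 < t < +oo))//.
    apply: eq_integral => t _; have [ty|ty] := leP t y%:E.
      by rewrite andbT (le_lt_trans ty) ?ltry// andbT.
    by rewrite andbF; case: ifP.
  apply: measurable_bool_set; apply: measurable_and.
    exact: measurable_fun_lte.
  exact: measurable_fun_lee.
rewrite -ge0_integralD//; last 4 first.
- by move=> t _; case: ifP.
- apply: measurable_funTS; apply: measurable_fun_ifT => //.
  exact: measurable_fun_lee.
- by move=> t _; exact: mule_ge0.
- exact: emeasurable_funM.
apply: eq_integral => t; rewrite inE/= => /andP[+ toy].
case: t toy => [t| |] // _; rewrite lte_fin lee_fin/= => {}t0.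
have ta : (t `^ (1 - 1 - alpha) = t `^ (- alpha))%R by congr (_ `^ _)%R; ring.
rewrite cintV// ta cweight1// -!EFinM tpow_sub_inv// tpow1 subr_gt0 subrr powRr0 mul1r.
have tt : (t `^ (- alpha) * t `^ alpha = 1)%R by rewrite powRN mulVf ?gt_eqF ?powR_gt0.
have an0 : alpha != 0%R by rewrite gt_eqF.
have E (m : R) : (alpha * (t `^ (- alpha) * (m / alpha)) = t `^ (- alpha) * m)%R.
  by field.
have [ty|yt] := leP t y; rewrite E; first by rewrite mul0r mulr0 adde0 tt.
by rewrite !mul1r add0e mulrC.
Qed.

End ClassM.

Section InversionFormula.
Context {R : realType}.
Local Notation leb := (@lebesgue_measure R).
Variables alpha eta : R.
Hypotheses (alpha_gt0 : 0 < alpha) (eta_gt0 : 0 < eta).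
Variable mu : {measure set (\bar R) -> \bar R}.
Variable rho : {measure set R -> \bar R}.
Hypothesis rhoE : represents_inversion alpha mu rho.
Hypothesis muM : classM alpha mu.
Variable tau : {measure set (\bar R) -> \bar R}.
Hypothesis tauE :
  forall B, measurable B -> tau B = kober_erdelyi alpha eta mu B.

Let rho_lty := inverted_lty alpha_gt0 rhoE muM.
Let rho_lt0 := inverted_lt0 rhoE.

Local Notation n := (Num.truncn eta).
Local Notation theta := (eta - n%:R).
Local Notation G := (Gamma (1 - theta)).

Let G_gt0 : 0 < G.
Proof. by apply: Gamma_gt0; have := truncnS_gt eta; rewrite -natr1; lra. Qed.

Local Open Scope ereal_scope.

Let EFin_RLn0 x : (RLn rho 0 x)%:E = RL rho 1 x.
Proof. by rewrite EFin_RLn// eRLn0 RL1. Qed.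

Let EFin_integrand (s : R) : (0 < s)%R ->
  (s `^ (alpha - 1) * (G * RLn rho 0 s^-1))%:E =
  G%:E * ((s `^ (alpha - 1))%:E * RL rho 1 (s^-1)%R).
Proof. by move=> s0; rewrite -EFin_RLn0 -!EFinM mulrCA. Qed.

Let measurable_integrand (y : R) : measurable_fun `]0%R, y[%classic
  (fun s : R => (s `^ (alpha - 1) * (G * RLn rho 0 s^-1))%R).
Proof.
apply/measurable_EFinP.
apply: (eq_measurable_fun (fun s : R => G%:E * ((s `^ (alpha - 1))%:E *
    (if (0 < s)%R then RL rho 1 (s^-1)%R else 0)))).
  by move=> s; rewrite inE/= in_itv/= => /andP[s0 _]; rewrite s0 EFin_integrand.
apply: measurable_funTS; apply: emeasurable_funM => //.
apply: emeasurable_funM; last exact: (measurable_RLV alpha_gt0 rhoE muM 1).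
by apply/measurable_EFinP; exact: measurable_powR.
Qed.

Let inv_iter_n (s : R) : (0 < s)%R -> mu [set s%:E] = 0 ->
  Defs.inv_iter alpha eta tau n s = (G * RLn rho 0 s^-1)%R.
Proof.
move=> s0 mus; have [] := inv_iter_spec alpha_gt0 eta_gt0 rhoE muM tauE s0 (leqnn n).
  by right; right.
by rewrite subnn.
Qed.

Let measurable_inv_iter_n (y : R) : measurable_fun `]0%R, y[%classic
  (fun s : R => (s `^ (alpha - 1) * Defs.inv_iter alpha eta tau n s)%R).
Proof.
refine (@countable_modification_measurable _ _ R _ (atoms mu) _ _ _ _ _
  (@measurable_integrand y)).
- by move=> x; exact: measurable_set1.
- exact: (countable_classM_atoms alpha_gt0 muM).
- move=> s; rewrite /= in_itv/= => /andP[s0 _] sN; rewrite inv_iter_n//.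
  by apply/eqP; apply: contrapT => /negP mus; apply: sN.
Qed.

Let ae_nonatom (P : R -> Prop) (y : R) :
  (forall s, (0 < s < y)%R -> mu [set s%:E] = 0 -> P s) ->
  {ae leb, forall s, `]0%R, y[%classic s -> P s}.
Proof.
move=> H; exists (atoms mu); split.
- apply: countable_measurable; last exact: (countable_classM_atoms alpha_gt0 muM).
  by move=> x; exact: measurable_set1.
- by apply: countable_lebesgue_measure0; exact: (countable_classM_atoms alpha_gt0 muM).
- move=> s /= /not_implyP[]; rewrite in_itv/= => /andP[s0 sy] Ps; split=> //.
  by apply: contra_notN Ps => /eqP mus; apply: H; rewrite ?s0.
Qed.

Let RL1_integral (y : R) : \bar R := \int[leb]_s (if (0 < s < y)%R then
    (s `^ (alpha - 1))%:E * RL rho 1 (s^-1)%R else 0).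

Let integral_integrand (y : R) :
  \int[leb]_(s in `]0%R, y[) (s `^ (alpha - 1) * (G * RLn rho 0 s^-1))%:E =
  G%:E * RL1_integral y.
Proof.
rewrite (@integral_boolE _ _ _ leb _ (fun s => (0 < s < y)%R)); last first.
  by move=> s; rewrite /= in_itv/=.
have mQ : measurable_fun setT (fun s : R => if (0 < s < y)%R then
    (s `^ (alpha - 1))%:E * RL rho 1 (s^-1)%R else 0).
  apply: (eq_measurable_fun (fun s : R => if (0 < s < y)%R then
    (s `^ (alpha - 1))%:E * (if (0 < s)%R then RL rho 1 (s^-1)%R else 0) else 0)).
    move=> s _; have [s0|_] := ltP 0%R s; last by [].
    by rewrite andTb.
  apply: measurable_fun_ifT => //; first exact: measurable_itvoo_bool.
  apply: emeasurable_funM; last exact: (measurable_RLV alpha_gt0 rhoE muM 1).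
  by apply/measurable_EFinP; exact: measurable_powR.
rewrite -(lebesgue_integralZl mQ); last 2 first.
- move=> s; case: ifP => _; last exact: lexx.
  by rewrite mule_ge0 ?RL_ge0// lee_fin powR_ge0.
- by rewrite lee_fin ltW.
apply: eq_integral => s _; have [s0|s0] := ltP 0%R s; last by rewrite mule0.
by rewrite andTb; case: ifP => _; [exact: EFin_integrand|rewrite mule0].
Qed.

Let mass_oc_lty (y : R) : (0 < y)%R -> mu [set t | 0 < t <= y%:E] < +oo.
Proof.
move=> y0; apply: le_lt_trans (classM_lty alpha_gt0 muM (ltr_wpDr ler01 y0)).
apply: le_measure; rewrite ?inE.
- apply: measurable_bool_set; apply: measurable_and.
    exact: measurable_fun_lte.
  exact: measurable_fun_lee.
- exact: measurable_eitvco.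
- move=> t /= /andP[/ltW -> ty] /=; rewrite (le_lt_trans ty)// lte_fin; lra.
Qed.

Let RL1_integralE (y : R) : (0 < y)%R -> RL1_integral y = (alpha^-1 *
  (fine (mu [set t | (0 < t <= y%:E)%E]) + y `^ alpha * RLn rho 0 y^-1))%:E.
Proof.
move=> y0; rewrite EFinM EFinD EFinM EFin_RLn0.
rewrite fineK ?ge0_fin_numE ?mass_oc_lty//.
rewrite -(integral_RL1_mass alpha_gt0 muM rhoE y0) muleA -EFinM.
by rewrite mulVf ?mul1e// gt_eqF.
Qed.

Lemma inversion_well_definedP : inversion_well_defined alpha eta mu tau.
Proof.
split.
- move=> x x0; apply/integrableP; split.
    by apply: measurable_funTS; exact: measurable_inv_kernel.
  under eq_integral do rewrite /= ger0_norm ?inv_kernel_ge0//.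
  by rewrite (integral_inv_kernel alpha_gt0 eta_gt0 rhoE muM tauE x0) ltry.
- move=> x k x0 kn kx.
  have [] := inv_iter_spec alpha_gt0 eta_gt0 rhoE muM tauE x0 (ltnW kn).
    by left.
  by move=> _ /(_ kn kx)[].
- move=> y y0; apply/integrableP; split.
    by apply/measurable_EFinP; exact: measurable_inv_iter_n.
  rewrite (@ae_eq_integral _ _ _ leb _ (fun s : R =>
    (s `^ (alpha - 1) * (G * RLn rho 0 s^-1))%:E)) //.
  + by rewrite integral_integrand RL1_integralE// -EFinM ltry.
  + by apply: measurableT_comp => //; apply/measurable_EFinP; exact: measurable_inv_iter_n.
  + by apply/measurable_EFinP; exact: measurable_integrand.
  + apply: ae_nonatom => s /andP[s0 _] mus; rewrite inv_iter_n//=.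
    rewrite ger0_norm// mulr_ge0 ?powR_ge0// mulr_ge0 ?(ltW G_gt0)//.
    by rewrite -lee_fin EFin_RLn0 RL_ge0.
Qed.

Lemma cdf_left_split (m : {measure set (\bar R) -> \bar R}) (y : R) :
  (0 < y)%R -> m [set y%:E] = 0 ->
  cdf_left m y = m [set 0] + m [set t | 0 < t <= y%:E].
Proof.
move=> y0 my.
have moo : measurable [set t : \bar R | 0 < t < y%:E] by exact: measurable_eitvoo.
have m1 (z : \bar R) : measurable [set z] by exact: emeasurable_set1.
have -> : m [set t | 0 < t <= y%:E] = m [set t | 0 < t < y%:E].
  have -> : [set t | 0 < t <= y%:E] = [set t | 0 < t < y%:E] `|` [set y%:E].
    apply/seteqP; split=> t /=.
      by rewrite le_eqVlt => /andP[t0 /predU1P[->|ty]]; [right|left; rewrite t0].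
    by move=> [/andP[-> /ltW ->]//|->]; rewrite lexx lte_fin y0.
  have U : m ([set t | 0 < t < y%:E] `|` [set y%:E]) =
      m [set t | 0 < t < y%:E] + m [set y%:E].
    apply: measureU => //; apply/seteqP; split=> // t [/= /andP[_ ty] tE].
    by move: ty; rewrite tE ltxx.
  by rewrite U my adde0.
have <- : m ([set 0] `|` [set t | 0 < t < y%:E]) =
    m [set 0] + m [set t | 0 < t < y%:E].
  apply: measureU => //; apply/seteqP; split=> // t [/= ->].
  by rewrite ltxx.
rewrite /cdf_left; congr (m _); apply/seteqP; split=> t /=.
  by rewrite le_eqVlt => /andP[/predU1P[<-|t0] ty]; [left|right; rewrite t0].
by move=> [->|/andP[/ltW -> ->]//]; rewrite lexx lte_fin.
Qed.

(** Almost everywhere the integrand is the one of [integral_RL1_mass]; the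
    subtracted term of the formula cancels [y `^ alpha * RL rho 1 (1 / y)] and
    leaves the mass of [(0, y]]. *)
Lemma inversion_formula (y : R) : (0 < y)%R -> mu [set y%:E] = 0 ->
  cdf_left mu y = inversion_rhs alpha eta tau y.
Proof.
move=> y0 muy; rewrite cdf_left_split// /inversion_rhs.
rewrite (tau_set0 alpha_gt0 eta_gt0 rhoE muM tauE); congr (_ + _).
rewrite /Rintegral (@ae_eq_integral _ _ _ leb _ (fun s : R =>
  (s `^ (alpha - 1) * (G * RLn rho 0 s^-1))%:E)) //; last 3 first.
- by apply/measurable_EFinP; exact: measurable_inv_iter_n.
- by apply/measurable_EFinP; exact: measurable_integrand.
- by apply: ae_nonatom => s /andP[s0 _] mus; rewrite inv_iter_n.
rewrite integral_integrand RL1_integralE// -EFinM/= inv_iter_n//.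
have -> : (n%:R + 1 - eta = 1 - theta)%R by ring.
rewrite -[LHS]fineK ?ge0_fin_numE ?mass_oc_lty//; congr (_%:E).
field.
by rewrite !gt_eqF.
Qed.

End InversionFormula.

(** * Growth of the transform at infinity *)

Section GrowthAtInfinity.
Context {R : realType}.
Variables alpha eta : R.
Hypotheses (alpha_gt0 : 0 < alpha) (eta_gt0 : 0 < eta).
Variable mu : {measure set (\bar R) -> \bar R}.
Variable rho : {measure set R -> \bar R}.
Hypothesis rhoE : represents_inversion alpha mu rho.
Hypothesis muM : classM alpha mu.
Variable tau : {measure set (\bar R) -> \bar R}.
Hypothesis tauE :
  forall B, measurable B -> tau B = kober_erdelyi alpha eta mu B.
Local Open Scope ereal_scope.

Let D : set (\bar R) := [set t | 0 < t < +oo].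
Let mD : measurable D. Proof. exact: measurable_eitvoo. Qed.

(** The contribution of the point [t] of [mu] to
    [y `^ (- alpha) * cdf_left tau y], up to the factor [1 / Gamma eta]. *)
Let h (y : R) (t : \bar R) : \bar R := (y `^ (- alpha))%:E *
  (cint alpha eta y (fine t)^-1%R * (fine t `^ (- alpha))%:E).

Let h_ge0 y t : 0 <= h y t.
Proof. by rewrite !mule_ge0 ?cint_ge0// lee_fin powR_ge0. Qed.

Let measurable_h y : measurable_fun D (h y).
Proof.
apply: emeasurable_funM => //; apply: measurable_inverted.
exact: measurable_cint.
Qed.

(** The first bound dominates [h] uniformly in [y] by a [mu]-integrable function;
    the second one shows that [h] vanishes pointwise at infinity. *)
Let h_bound : exists2 C : R, (0 < C)%R & forall (y : R) t, (1 <= y)%R -> D t ->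
  h y t <= (C * (1 + fine t) `^ (- alpha))%:E /\ h y t <= (C * y `^ (- alpha))%:E.
Proof.
have [C C0 CE] := cint_bound alpha_gt0 eta_gt0.
have two : (1 <= 2 `^ alpha :> R)%R.
  by rewrite -[leLHS](powRr0 2) ler_powR// ?ler1n// ltW.
exists (C * 2 `^ alpha)%R; first by rewrite mulr_gt0// (lt_le_trans ltr01).
move=> y t y1 /andP[t0 toy].
have y0 : (0 < y)%R by exact: lt_le_trans y1.
have {toy}t0 : (0 < fine t)%R by rewrite fine_gt0// t0.
have [h1 h2] := CE y (fine t) y0 t0.
have ya : 0 <= (y `^ (- alpha))%:E by rewrite lee_fin powR_ge0.
have {}h1 : h y t <= (C * y `^ (- alpha))%:E.
  by apply: le_trans (lee_wpmul2l ya h1) _; rewrite -EFinM mulrC.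
have {}h2 : h y t <= (C * fine t `^ (- alpha))%:E.
  apply: le_trans (lee_wpmul2l ya h2) _; rewrite -EFinM lee_fin.
  rewrite [X in (X <= _)%R](_ : _ =
    (y `^ (- alpha) * y `^ alpha) * (C * fine t `^ (- alpha)))%R; last by ring.
  by rewrite (powRN y) mulVf ?mul1r// gt_eqF// powR_gt0.
split; last first.
  apply: (le_trans h1); rewrite lee_fin ler_wpM2r ?powR_ge0//.
  by rewrite ler_peMr// ltW.
have t10 : (0 < 1 + fine t)%R by rewrite addr_gt0.
have [t1|t1] := leP (fine t) 1%R.
  apply: (le_trans h1); rewrite lee_fin -mulrA ler_wpM2l ?(ltW C0)//.
  apply: (@le_trans _ _ 1%R).
    by rewrite powRN invf_le1 ?powR_gt0// -[leLHS](powRr0 y) ler_powR// ltW.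
  rewrite powRN ler_pdivlMr ?powR_gt0// mul1r.
  by apply: ge0_ler_powR; rewrite ?nnegrE ?(ltW t10) ?(ltW alpha_gt0)//; lra.
apply: (le_trans h2); rewrite lee_fin -mulrA ler_wpM2l ?(ltW C0)//.
rewrite !powRN ler_pdivlMr ?powR_gt0// mulrC ler_pdivrMr ?powR_gt0//.
rewrite -powRM ?(ltW t0)//.
by apply: ge0_ler_powR; rewrite ?nnegrE ?mulr_ge0 ?(ltW t10) ?(ltW t0) ?(ltW alpha_gt0)//; lra.
Qed.

Let integrable_weight (C : R) : (0 < C)%R ->
  mu.-integrable D (fun t => (C * (1 + fine t) `^ (- alpha))%:E).
Proof.
move=> C0; have [_ muf _] := muM.
have w0 (t : \bar R) : 0 <= ((1 + fine t) `^ (- alpha))%:E by rewrite lee_fin powR_ge0.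
apply/integrableP; split.
  apply: measurable_funTS; under eq_fun do rewrite EFinM.
  by apply: emeasurable_funM => //; exact: measurable_weight.
have -> : \int[mu]_(t in D) `|(C * (1 + fine t) `^ (- alpha))%:E| =
    \int[mu]_(t in D) (C%:E * ((1 + fine t) `^ (- alpha))%:E).
  apply: eq_integral => t _; rewrite EFinM gee0_abs//.
  by apply: mule_ge0 => //; rewrite lee_fin ltW.
rewrite ge0_integralZl//; last 2 first.
- by apply: measurable_funTS; exact: measurable_weight.
- by rewrite lee_fin ltW.
rewrite lte_mul_pinfty ?lee_fin ?(ltW C0)//; apply: le_lt_trans muf.
apply: ge0_subset_integral => //.
- exact: measurable_eitvco.
- by apply: measurable_funTS; exact: measurable_weight.
- by move=> t /= /andP[/ltW -> ->].
Qed.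

Let integral_h_lty (y : R) : (1 <= y)%R -> \int[mu]_(t in D) h y t < +oo.
Proof.
move=> y1; have [C C0 CE] := h_bound.
have /integrableP[_] := integrable_weight C0; apply: le_lt_trans.
apply: ge0_le_integral => //.
- by apply: measurableT_comp => //; have /integrableP[] := integrable_weight C0.
- by move=> t Dt; rewrite gee0_abs ?lee_fin ?mulr_ge0 ?powR_ge0 ?(ltW C0)//; have [] := CE y t y1 Dt.
Qed.

Let integral_h_cvg0 : \int[mu]_(t in D) h y t @[y --> +oo%R] --> 0.
Proof.
(* Dominated convergence is for sequences; [v] is [u] pushed into the range
   [1 <= y] where the bounds on [h] hold. *)
apply/cvge_pinftyP => u /cvgryPge uoo.
have [C C0 CE] := h_bound.
pose v k := Num.max 1%R (u k).
have voo : v k @[k --> \oo] --> +oo%R.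
  apply/cvgryPge => A; near=> k; rewrite le_max.
  by apply/orP; right; near: k; exact: uoo.
suff : \int[mu]_(t in D) h (v k) t @[k --> \oo] --> 0.
  apply: cvg_trans; apply: near_eq_cvg; near=> k.
  rewrite /v (max_idPr _)//; near: k; exact: uoo.
have v1 k : (1 <= v k)%R by rewrite le_max lexx.
have vN : (v k `^ (- alpha))%R @[k --> \oo] --> 0%R.
  exact: (cvg_comp _ _ voo (powRN_cvg0 alpha_gt0)).
have [] := @dominated_convergence _ _ _ mu D mD (fun k => h (v k)) (cst 0)
  (fun t => (C * (1 + fine t) `^ (- alpha))%:E).
- by move=> k; exact: measurable_h.
- exact: measurable_cst.
- apply: aeW => t Dt.
  apply: (@squeeze_cvge _ _ _ _ (cst 0) _ (fun k => (C * v k `^ (- alpha))%R%:E)).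
  + near=> k; rewrite h_ge0/=; have [] := CE (v k) t (v1 k) Dt.
    by [].
  + exact: cvg_cst.
  + apply: cvg_EFin; first exact: nearW.
    rewrite -[X in _ --> X](mulr0 C); apply: cvgMr; exact: vN.
- exact: integrable_weight.
- apply: aeW => t k Dt; rewrite gee0_abs//.
  by have [] := CE (v k) t (v1 k) Dt.
by move=> _ _; rewrite integral0.
Unshelve. all: by end_near. Qed.

Let mu0_fin : mu [set 0] \is a fin_num.
Proof.
rewrite ge0_fin_numE//; apply: le_lt_trans (classM_lty alpha_gt0 muM ltr01).
apply: le_measure; rewrite ?inE//; first exact: measurable_eitvco.
by move=> _ /= ->; rewrite lexx lte_fin ltr01.
Qed.

Let muy_fin : mu [set +oo] \is a fin_num.
Proof. by rewrite ge0_fin_numE//; have [] := muM. Qed.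

Let scaled_cdf (y : R) : (0 < y)%R -> (y `^ (- alpha))%:E * cdf_left tau y =
  (y `^ (- alpha) * fine (mu [set 0%E]))%:E +
  ((Gamma eta)^-1%:E * (alpha^-1%:E * mu [set +oo] + \int[mu]_(t in D) h y t)).
Proof.
move=> y0; rewrite (cdf_left_tau alpha_gt0 eta_gt0 rhoE muM tauE y0).
have G0 : 0 <= (Gamma eta)^-1%:E by rewrite lee_fin invr_ge0 ltW// Gamma_gt0.
have c0 (t : \bar R) : 0 <= cint alpha eta y (fine t)^-1%R * (fine t `^ (- alpha))%:E.
  by rewrite mule_ge0 ?cint_ge0// lee_fin powR_ge0.
have I0 : 0 <= \int[mu]_(t in D) (cint alpha eta y (fine t)^-1%R * (fine t `^ (- alpha))%:E).
  exact: integral_ge0.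
have M0 : 0 <= (y `^ alpha / alpha)%:E * mu [set +oo].
  by rewrite mule_ge0// lee_fin divr_ge0 ?powR_ge0// ltW.
rewrite ge0_muleDr//; last by rewrite mule_ge0// adde_ge0.
rewrite -{1}(fineK mu0_fin) -EFinM; congr (_ + _).
rewrite muleCA; congr (_ * _); rewrite ge0_muleDr//; congr (_ + _).
  rewrite muleA -EFinM; congr (_%:E * _).
  by rewrite powRN mulrA mulVf ?mul1r// gt_eqF ?powR_gt0.
rewrite -ge0_integralZl//.
- by apply: measurable_inverted; exact: measurable_cint.
- by rewrite lee_fin powR_ge0.
Qed.

Lemma cdf_left_tau_cvg : (y `^ (- alpha))%:E * cdf_left tau y @[y --> +oo%R] -->
  ((Gamma eta)^-1 * (alpha^-1 * fine (mu [set +oo%E])))%:E.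
Proof.
have H0 : (y `^ (- alpha) * fine (mu [set 0%E]))%:E @[y --> +oo%R] --> 0.
  apply: cvg_EFin; first exact: nearW.
  rewrite -[X in _ --> X](mul0r (fine (mu [set 0%E]))).
  by apply: cvgMl; exact: powRN_cvg0.
have H1 : (Gamma eta)^-1%:E * (alpha^-1%:E * mu [set +oo] + \int[mu]_(t in D) h y t)
    @[y --> +oo%R] --> (Gamma eta)^-1%:E * (alpha^-1%:E * mu [set +oo] + 0).
  apply: cvgeZl => //; apply: cvgeD; [|exact: cvg_cst|exact: integral_h_cvg0].
  by rewrite fin_num_adde_defl.
have ad : 0 +? ((Gamma eta)^-1%:E * (alpha^-1%:E * mu [set +oo] + 0)).
  exact: fin_num_adde_defr.
have -> : ((Gamma eta)^-1 * (alpha^-1 * fine (mu [set +oo%E])))%:E =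
    0 + (Gamma eta)^-1%:E * (alpha^-1%:E * mu [set +oo] + 0).
  by rewrite add0e adde0 !EFinM fineK.
apply: cvg_trans (cvgeD ad H0 H1).
apply: near_eq_cvg; near=> y.
have y0 : (0 < y)%R by near: y; exact: nbhs_pinfty_gt.
by rewrite scaled_cdf.
Unshelve. all: by end_near. Qed.

Lemma cdf_left_tau_lty (y : R) : (1 <= y)%R -> cdf_left tau y < +oo.
Proof.
move=> y1; have y0 : (0 < y)%R by exact: lt_le_trans y1.
have ya : (0 < y `^ (- alpha))%R by rewrite powR_gt0.
suff : (y `^ (- alpha))%:E * cdf_left tau y < +oo.
  rewrite ltey; apply: contraTT; rewrite -leNgt leye_eq => /eqP ->.
  by rewrite gt0_muley ?lte_fin// eqxx.
rewrite scaled_cdf// lte_add_pinfty ?ltry// lte_mul_pinfty//.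
  by rewrite lee_fin invr_ge0 ltW// Gamma_gt0.
by rewrite lte_add_pinfty ?integral_h_lty// -(fineK muy_fin) -EFinM ltry.
Qed.

(** Near [0] the measure [tau] is finite by the formula for its distribution
    function; in the tail [(1 + t) `^ (- alpha - eta)] is at most the inversion
    kernel at [x = 1], whose integral is known to be finite. *)
Lemma kober_erdelyi_classM : classM (alpha + eta) tau.
Proof.
split.
- rewrite tauE; last first.
    apply: measurable_bool_set; exact: measurable_fun_lte.
  rewrite (kober_erdelyi_density alpha_gt0 eta_gt0 rhoE muM); last first.
    apply: measurable_bool_set; exact: measurable_fun_lte.
  rewrite (_ : _ `&` _ = set0) ?measure0 ?add0e.
    rewrite integral0_eq// => y /=; rewrite lte_fin => y0.
    by rewrite /kdensity ltNge (ltW y0).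
  by apply/seteqP; split=> // t [/= + tE]; rewrite tE ltxx.
- pose f t : \bar R := (if 0 <= t < 2%:E then 1 else 0) +
    (if 1%:E < t < +oo then (inv_kernel alpha eta 1 t)%:E else 0).
  have k0 (t : \bar R) : 0 <= (inv_kernel alpha eta 1 t)%:E.
    by rewrite lee_fin inv_kernel_ge0.
  have f1_ge0 (t : \bar R) : 0 <= (if 0 <= t < 2%:E then 1 else 0 : \bar R).
    by case: ifP.
  have f2_ge0 (t : \bar R) :
      0 <= (if 1%:E < t < +oo then (inv_kernel alpha eta 1 t)%:E else 0).
    by case: ifP => _; [exact: k0|exact: lexx].
  have mf1 : measurable_fun setT (fun t : \bar R => (if 0 <= t < 2%:E then 1 else 0) : \bar R).
    by apply: measurable_fun_ifT => //; exact: measurable_eitvco_bool.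
  have mf2 : measurable_fun setT (fun t : \bar R =>
      if 1%:E < t < +oo then (inv_kernel alpha eta 1 t)%:E else 0).
    apply: measurable_fun_ifT => //; first exact: measurable_eitvoo_bool.
    exact: measurable_inv_kernel.
  have mf : measurable_fun setT f by exact: emeasurable_funD.
  have f0 t : 0 <= f t by exact: adde_ge0.
  apply: (@le_lt_trans _ _ (\int[tau]_t f t)).
    apply: (@le_trans _ _ (\int[tau]_(t in [set t | 0 <= t < +oo]) f t)); last first.
      by apply: ge0_subset_integral => //; exact: measurable_eitvco.
    apply: ge0_le_integral => //.
    + exact: measurable_eitvco.
    + by move=> t _; rewrite lee_fin powR_ge0.
    + by apply: measurable_funTS; exact: measurable_weight.
    + exact: measurable_funTS.
    + move=> [t| |]; rewrite /= ?andbF// lee_fin => /andP[t0 _].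
      rewrite /f lee_fin t0 !lte_fin ltry andbT /=.
      have [t2|t2] := ltP t 2%R.
        apply: (@le_trans _ _ 1); last first.
          by apply: leeDl; case: ifP => _; [exact: (k0 t%:E)|exact: lexx].
        have t10 : (0 < 1 + t)%R by lra.
        rewrite lee_fin powRN invf_le1 ?powR_gt0// -[leLHS](powRr0 (1 + t)).
        by rewrite ler_powR ?addr_ge0 ?(ltW alpha_gt0) ?(ltW eta_gt0)//; lra.
      have t1 : (1 < t)%R by lra.
      rewrite t1 add0e lee_fin /inv_kernel/= powRN lef_pV2 ?posrE; last 2 first.
      * by rewrite powR_gt0//; lra.
      * by rewrite mulr_gt0 ?powR_gt0//; lra.
      have tn0 : (t != 0)%R by rewrite gt_eqF//; lra.
      have th0 : (0 <= eta - (Num.truncn eta)%:R)%R.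
        by rewrite subr_ge0 truncn_le// ltW.
      have -> : (alpha + eta = (alpha + (Num.truncn eta)%:R) +
          (eta - (Num.truncn eta)%:R))%R by ring.
      apply: (@le_trans _ _ (t `^ (alpha + (Num.truncn eta)%:R +
          (eta - (Num.truncn eta)%:R)))%R).
        rewrite [leRHS]powRD ?tn0 ?implybT// ler_wpM2l ?powR_ge0//.
        by apply: ge0_ler_powR; rewrite ?nnegrE//; lra.
      have e0 : (0 <= alpha + (Num.truncn eta)%:R + (eta - (Num.truncn eta)%:R))%R.
        by rewrite addrA addrAC addrK addr_ge0 ?(ltW alpha_gt0) ?(ltW eta_gt0).
      have t11 : (0 <= 1 + t)%R by lra.
      by apply: ge0_ler_powR; rewrite ?nnegrE// lerDr.
  rewrite ge0_integralD// lte_add_pinfty//.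
    rewrite -(@integral_boolE _ _ _ tau [set t | 0 <= t < 2%:E])//.
    rewrite integral_cst ?mul1e; last exact: measurable_eitvco.
    by apply: cdf_left_tau_lty; rewrite ler1n.
  rewrite -(@integral_boolE _ _ _ tau [set t | 1%:E < t < +oo])//.
  by rewrite (integral_inv_kernel alpha_gt0 eta_gt0 rhoE muM tauE ltr01) ltry.
- rewrite tauE; last exact: emeasurable_set1.
  rewrite (kober_erdelyi_density alpha_gt0 eta_gt0 rhoE muM); last exact: emeasurable_set1.
  rewrite (_ : _ `&` _ = set0) ?measure0 ?add0e.
    by rewrite integral0_eq.
  by apply/seteqP; split=> // t [/= -> ].
Qed.

End GrowthAtInfinity.

(** * Measures of the class from their distribution functions *)

Section Uniqueness.
Context {R : realType}.
Variable alpha : R.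
Hypothesis alpha_gt0 : 0 < alpha.
Local Open Scope ereal_scope.
Implicit Types mu : {measure set (\bar R) -> \bar R}.

(** An interval is uncountable, whereas the atoms of both measures are countable
    in number. *)
Lemma exists_nonatom mu mu' (a b : R) : classM alpha mu -> classM alpha mu' ->
  (0 <= a < b)%R ->
  exists y, [/\ (a < y < b)%R, mu [set y%:E] = 0 & mu' [set y%:E] = 0].
Proof.
move=> muM muM' /andP[a0 ab]; apply: contrapT => noy.
have cN : countable (atoms mu `|` atoms mu').
  have -> : atoms mu `|` atoms mu' =
      \bigcup_(i in [set: bool]) (if i then atoms mu else atoms mu').
    apply/seteqP; split=> x; first by move=> [xN|xN]; [exists true|exists false].
    by move=> [[] _ xN]; [left|right].
  apply: bigcup_countable => //.
  by move=> [] _; [exact: (countable_classM_atoms alpha_gt0 muM)|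
                   exact: (countable_classM_atoms alpha_gt0 muM')].
have : lebesgue_measure (`]a, b[%classic : set R) = 0.
  apply: countable_lebesgue_measure0; apply: sub_countable cN.
  apply: subset_card_le => y; rewrite /= in_itv/= => /andP[ay yb].
  have y0 : (0 < y)%R by exact: le_lt_trans ay.
  apply: contrapT => /not_orP[yN yN']; apply: noy; exists y; split.
  - by rewrite ay.
  - by apply/eqP; apply: contrapT => /negP mus; apply: yN.
  - by apply/eqP; apply: contrapT => /negP mus; apply: yN'.
rewrite lebesgue_measure_itv/= lte_fin ab -EFinB => /eqP.
by rewrite eqe subr_eq0 gt_eqF.
Qed.

(** [cdf_left mu x] is the limit of the masses of [[0, x - 1 / k)], and between
    [x - 1 / k] and [x] there is a common nonatom [y], at which the two
    distribution functions agree. *)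
Lemma cdf_left_le mu mu' (x : R) : classM alpha mu -> classM alpha mu' ->
  (forall y : R, (0 < y)%R -> mu [set y%:E] = 0 -> mu' [set y%:E] = 0 ->
     cdf_left mu y = cdf_left mu' y) ->
  (0 < x)%R -> cdf_left mu x <= cdf_left mu' x.
Proof.
move=> muM muM' H x0.
pose F k : set (\bar R) := [set t | 0 <= t < (x - k.+1%:R^-1)%:E].
have FU : \bigcup_k F k = [set t | 0 <= t < x%:E].
  apply/seteqP; split=> t.
    move=> [k _ /= /andP[-> tx]]; rewrite (lt_le_trans tx)// lee_fin.
    by rewrite lerBlDr lerDl.
  move=> /= /andP[t0 tx].
  have tf : t \is a fin_num by rewrite ge0_fin_numE// (lt_trans tx) ?ltry.
  have {}tx : (fine t < x)%R by rewrite -lte_fin fineK.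
  exists (Num.truncn (x - fine t)^-1) => //=.
  rewrite /F/= t0 -(fineK tf) lte_fin ltrBrDr -ltrBrDl.
  rewrite -[ltRHS]invrK ltf_pV2 ?posrE ?invr_gt0 ?subr_gt0//.
  exact: truncnS_gt.
have cF : mu (F k) @[k --> \oo] --> cdf_left mu x.
  rewrite /cdf_left -FU; apply: nondecreasing_cvg_mu.
  - by move=> k; exact: measurable_eitvco.
  - by rewrite FU; exact: measurable_eitvco.
  - move=> m n mn; apply/subsetPset => t /= /andP[t0 tx].
    rewrite /F/= t0 (lt_le_trans tx)//.
    by rewrite lee_fin lerB// lef_pV2 ?posrE// ler_nat.
apply: cvge_le cF; apply: nearW => k.
have [y [/andP[ay yx] muy muy']] : exists y, [/\ (Num.max 0 (x - k.+1%:R^-1) < y < x)%R,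
    mu [set y%:E] = 0 & mu' [set y%:E] = 0].
  apply: exists_nonatom => //; rewrite le_max lexx/= gt_max x0/=.
  by rewrite ltrBlDr ltrDl.
move: ay; rewrite gt_max => /andP[y0 ay].
apply: (@le_trans _ _ (cdf_left mu y)).
  apply: le_measure; rewrite ?inE; [exact: measurable_eitvco|exact: measurable_eitvco|].
  by move=> t /= /andP[-> ty]; rewrite (lt_trans ty).
rewrite H//; apply: le_measure; rewrite ?inE;
  [exact: measurable_eitvco|exact: measurable_eitvco|].
by move=> t /= /andP[-> ty]; rewrite (lt_trans ty).
Qed.

(** Half-lines generate the Borel sets of the reals; moving the restriction of
    [mu] to its finite points there makes uniqueness a matter of half-lines. *)
Lemma finite_part_exists mu : exists nu : {measure set (measurableTypeR R) -> \bar R},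
  forall A, measurable A -> nu A = mu ((fine @^-1` A) `&` [set t | -oo < t < +oo]).
Proof.
pose phi : \bar R -> measurableTypeR R := fine.
have mphi : measurable_fun setT phi by exact: measurable_fine_setT.
pose g (t : \bar R) : \bar R := if -oo < t < +oo then 1 else 0.
have mg : measurable_fun setT g.
  by apply: measurable_fun_ifT => //; exact: measurable_eitvoo_bool.
have g0 t : 0 <= g t by rewrite /g; case: ifP.
have [nu nuE] := @image_density_exists _ _ _ _ R mu phi g mphi mg g0.
exists nu => A mA; rewrite nuE.
have mB : measurable ((phi @^-1` A) `&` [set t | -oo < t < +oo]).
  apply: measurableI; last exact: measurable_eitvoo.
  by rewrite -[X in measurable X]setTI; exact: mphi.
rewrite -[RHS]mul1e -integral_cst// [LHS]integral_mkcond [RHS]integral_mkcond.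
apply: eq_integral => t _; rewrite !patchE in_setI /g.
case: (t \in phi @^-1` A) => //=; rewrite [t \in _]inE/= asboolb.
by case: ifP.
Qed.

(** The finite parts agree on the half-lines [(-oo, x)], a family closed under
    intersection that generates the Borel sets and on which the measures are
    finite; what remains is the null set of negative points and the atom at
    infinity. *)
Lemma classM_measure_unique mu mu' : classM alpha mu -> classM alpha mu' ->
  (forall y : R, (0 < y)%R -> mu [set y%:E] = 0 -> mu' [set y%:E] = 0 ->
     cdf_left mu y = cdf_left mu' y) ->
  mu [set +oo] = mu' [set +oo] ->
  forall B, measurable B -> mu B = mu' B.
Proof.
move=> muM muM' H Hoo B mB.
have cdfE x : (0 < x)%R -> cdf_left mu x = cdf_left mu' x.
  move=> x0; apply: le_anti; rewrite cdf_left_le//= cdf_left_le// => y y0 muy' muy.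
  by rewrite H.
have [nu nuE] := finite_part_exists mu; have [nu' nuE'] := finite_part_exists mu'.
have null m A : classM alpha m -> measurable A -> A `<=` [set t | t < 0] -> m A = 0.
  move=> [m0 _ _] mA A0; apply/eqP; rewrite eq_le measure_ge0 andbT -m0.
  apply: le_measure; rewrite ?inE//.
  by apply: measurable_bool_set; exact: measurable_fun_lte.
have ray m (m_ : {measure set (measurableTypeR R) -> \bar R}) (x : R) : classM alpha m ->
    (forall A, measurable A -> m_ A = m ((fine @^-1` A) `&` [set t | -oo < t < +oo])) ->
    m_ `]-oo, x[%classic = if (0 < x)%R then cdf_left m x else 0.
  move=> mM mE; rewrite mE//.
  have -> : fine @^-1` `]-oo, x[%classic `&` [set t | -oo < t < +oo] =
      [set t | -oo < t < x%:E].
    apply/seteqP; split=> -[t| |] //=; rewrite ?in_itv/= ?ltNyr ?ltry ?lte_fin.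
    - by move=> [].
    - by move=> [].
    - by move=> [].
    - by move=> /andP[_ ->].
  case: ifPn => x0; last first.
    apply: null => //; first exact: measurable_eitvoo.
    move=> t /= /andP[_ /lt_le_trans]; apply; rewrite lee_fin leNgt//.
  have -> : [set t | -oo < t < x%:E] = [set t | -oo < t < 0] `|` [set t | 0 <= t < x%:E].
    apply/seteqP; split=> t /=.
      by move=> /andP[t1 tx]; have [t0|t0] := ltP t 0; [left; rewrite t1|right; rewrite tx].
    move=> [/andP[-> t0]|/andP[t0 ->]]; first by rewrite (lt_trans t0).
    by rewrite (lt_le_trans _ t0)// ltNyr.
  rewrite (_ : m _ = m [set t | -oo < t < 0] + m [set t | 0 <= t < x%:E]).
    by rewrite null ?add0e//; [exact: measurable_eitvoo|move=> t /= /andP[]].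
  apply: measureU; [exact: measurable_eitvoo|exact: measurable_eitvco|].
  apply/seteqP; split=> // t [/= /andP[_ t0] /andP[t0' _]].
  by move: t0; rewrite ltNge t0'.
have nunu' A : measurable A -> nu A = nu' A.
  apply: (@measure_unique _ R (measurableTypeR R) (@RGenInftyO.G R)
    (fun k => `]-oo, k%:R[%classic)).
  - exact: RGenInftyO.measurableE.
  - move=> _ _ [x ->] [y ->]; exists (Num.min x y).
    by apply/seteqP; split=> z /=; rewrite !in_itv/= lt_min => /andP.
  - by move=> k; exists k%:R.
  - apply/seteqP; split=> // x _; exists (Num.truncn `|x|).+1 => //=.
    by rewrite in_itv/= (le_lt_trans (ler_norm x))// truncnS_gt.
  - move=> _ [x ->]; rewrite (ray mu nu x muM nuE) (ray mu' nu' x muM' nuE').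
    by case: ifP => // x0; exact: cdfE.
  - move=> k; rewrite (ray mu nu _ muM nuE); case: ifP => // k0.
    exact: (classM_lty alpha_gt0 muM k0).
have mFin : measurable [set t : \bar R | -oo < t < +oo] by exact: measurable_eitvoo.
have m1 (z : \bar R) : measurable [set z] by exact: emeasurable_set1.
have mE : measurable (EFin @^-1` B : set (measurableTypeR R)).
  exact: measurable_EFin_preimage.
have dec m : classM alpha m -> m B =
    m ((fine @^-1` (EFin @^-1` B)) `&` [set t | -oo < t < +oo]) + m (B `&` [set +oo]).
  move=> mM.
  have -> : (fine @^-1` (EFin @^-1` B)) `&` [set t : \bar R | -oo < t < +oo] =
      B `&` [set t | -oo < t < +oo].
    by apply/seteqP; split=> -[t| |] [/= ? ?]; split.
  have mBF := measurableI _ _ mB mFin.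
  have mBy := measurableI _ _ mB (m1 +oo); have mBN := measurableI _ _ mB (m1 -oo).
  have {1}-> : B = (B `&` [set t | -oo < t < +oo] `|` B `&` [set +oo]) `|` B `&` [set -oo].
    apply/seteqP; split=> [t Bt|t [[]|] []//].
    by move: t Bt => [t| |] Bt; [left; left; split=> //=; rewrite ltNyr ltry|left; right|right].
  have U1 : m ((B `&` [set t | -oo < t < +oo] `|` B `&` [set +oo]) `|` B `&` [set -oo]) =
      m (B `&` [set t | -oo < t < +oo] `|` B `&` [set +oo]) + m (B `&` [set -oo]).
    apply: measureU => //; first exact: measurableU.
    by apply/seteqP; split=> // t [[[_ /= /andP[+ _]]|[_ ->]] [_ tE]] //; rewrite tE.
  have U2 : m (B `&` [set t | -oo < t < +oo] `|` B `&` [set +oo]) =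
      m (B `&` [set t | -oo < t < +oo]) + m (B `&` [set +oo]).
    apply: measureU => //.
    by apply/seteqP; split=> // t [[_ /= /andP[_ +]] [_ tE]]; rewrite tE.
  rewrite U1 U2 [X in _ + X]null ?adde0//.
  by move=> t [_ ->] /=; rewrite ltNyr.
rewrite (dec _ muM) (dec _ muM') -nuE// -nuE'// nunu'//; congr (_ + _).
have [Boo|Boo] := pselect (B +oo).
  have -> // : B `&` [set +oo] = [set +oo] by apply/seteqP; split=> [t []|t /= ->].
have -> : B `&` [set +oo] = set0 by apply/seteqP; split=> // t [Bt tE]; apply: Boo; rewrite -tE.
by rewrite !measure0.
Qed.

End Uniqueness.

(** * Recovering a measure from its transform *)

Unset Implicit Arguments.

Theorem theoremA2 (R : realType) (alpha eta : R)
    (mu : {measure set (\bar R) -> \bar R}) :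
  0 < alpha -> 0 < eta -> classM alpha mu ->
  exists tau : {measure set (\bar R) -> \bar R},
    [/\ forall B : set (\bar R), measurable B ->
          tau B = kober_erdelyi alpha eta mu B,
        classM (alpha + eta) tau,
        inversion_well_defined alpha eta mu tau /\
        (forall y : R, 0 < y -> mu [set y%:E] = 0%E ->
           cdf_left mu y = inversion_rhs alpha eta tau y),
        cvg ((y `^ (- alpha))%:E * cdf_left tau y @[y --> +oo%R])%E /\
        mu [set +oo%E] =
          ((alpha * Gamma eta)%:E *
           lim ((y `^ (- alpha))%:E * cdf_left tau y @[y --> +oo%R]))%E
      & forall mu' : {measure set (\bar R) -> \bar R}, classM alpha mu' ->
          (forall B : set (\bar R), measurable B ->
             tau B = kober_erdelyi alpha eta mu' B) ->
          forall B : set (\bar R), measurable B -> mu' B = mu B].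
Proof.
move=> alpha0 eta0 muM.
have [rho rhoE] := inverted_measure_exists alpha mu.
have [tau tauE] := kober_erdelyi_measure_exists alpha0 eta0 rhoE muM.
have growth (m : {measure set (\bar R) -> \bar R}) : classM alpha m ->
    (forall B, measurable B -> tau B = kober_erdelyi alpha eta m B) ->
    cvg ((y `^ (- alpha))%:E * cdf_left tau y @[y --> +oo%R])%E /\
    m [set +oo%E] = ((alpha * Gamma eta)%:E *
      lim ((y `^ (- alpha))%:E * cdf_left tau y @[y --> +oo%R]))%E.
  move=> mM mE; have [r rE] := inverted_measure_exists alpha m.
  have c := cdf_left_tau_cvg alpha0 eta0 rE mM mE.
  split; first by apply/cvg_ex; eexists; exact: c.
  rewrite (cvg_lim _ c)// -EFinM.
  have moo : m [set +oo%E] \is a fin_num by rewrite ge0_fin_numE//; have [] := mM.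
  rewrite -[LHS]fineK//; congr (_%:E); field.
  by rewrite !gt_eqF ?Gamma_gt0.
exists tau; split=> //.
- exact: (kober_erdelyi_classM alpha0 eta0 rhoE muM tauE).
- split; first exact: (inversion_well_definedP alpha0 eta0 rhoE muM tauE).
  by move=> y; exact: (inversion_formula alpha0 eta0 rhoE muM tauE).
- exact: growth.
- move=> mu' muM' tauE' B mB; have [rho' rhoE'] := inverted_measure_exists alpha mu'.
  apply: (classM_measure_unique alpha0 muM' muM) => //.
    move=> y y0 muy' muy.
    rewrite (inversion_formula alpha0 eta0 rhoE muM tauE y0 muy).
    by rewrite (inversion_formula alpha0 eta0 rhoE' muM' tauE' y0 muy').
  by rewrite (growth mu' muM' tauE').2 (growth mu muM tauE).2.
Qed.
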